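(* Let $m\ge 3$ and let $G=\langle x,y,t\mid t^{2^m}=1,\ x^2=y^2=t,\ t\text{ central},\ (x,y)=t^{2^{m-1}}\rangle$ be a group of type $\mathcal{D}_2$. Then $\mathbb{Q}G$ is the direct sum of $2m+2$ fields and one quaternion algebra. Let $K$ be a finite field of odd order $q$. Then $KG$ has at least $4m$ simple components in its Wedderburn decomposition. If $q\equiv 3\pmod 8$, this minimal number is achieved: in this case, $KG$ is the direct sum of $4m-2$ fields and two quaternion algebras (each necessarily a ring of $2\times2$ matrices over a field).
   Context: $(x,y)$ denotes the group commutator of $x$ and $y$. The group $G$ has order $4\cdot 2^m$ and centre $\langle t\rangle$ of order $2^m$. A quaternion algebra means a $4$-dimensional central simple algebra over its centre (a field extension of the ground field); $2\times2$ matrix rings over fields are included. ''Direct sum'' means direct sum of algebras. *)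

(* Defs.v *)
From HB Require Import structures.
From mathcomp Require Import all_boot all_order all_algebra all_fingroup.
From mathcomp Require Import all_solvable all_field.

Set Implicit Arguments.
Unset Strict Implicit.
Unset Printing Implicit Defensive.

Import GRing.Theory.
Local Open Scope ring_scope.

(* The group algebra K[gT]: an element is its family of coefficients.  The    *)
(* alias hides the pointwise product that {ffun gT -> K} already carries.     *)
Definition group_algebra (K : fieldType) (gT : finGroupType) : Type :=
  {ffun gT -> K^o}.

Section GroupAlgebra.
Variables (K : fieldType) (gT : finGroupType).
Local Notation KG := (group_algebra K gT).

HB.instance Definition _ := GRing.Lmodule.copy KG {ffun gT -> K^o}.

Definition galg_one : KG := [ffun g : gT => ((g == 1%g)%:R : K^o)].

(* The coefficient at g collects the pairs (h, k) with h k = g. *)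
Definition galg_mul (a b : KG) : KG :=
  [ffun g : gT => (\sum_(h : gT) (a h : K) * b (h^-1 * g)%g : K^o)].

Fact galg_mulA : associative galg_mul.
Proof.
move=> a b c; apply/ffunP=> g; rewrite !ffunE.
under eq_bigr do rewrite ffunE big_distrr /=.
under [RHS]eq_bigr do rewrite ffunE big_distrl /=.
rewrite [RHS]exchange_big /=; apply: eq_bigr => h _.
rewrite [RHS](reindex_inj (mulgI h)) /=; apply: eq_bigr => k _.
by rewrite mulrA mulKg invMg mulgA.
Qed.

Fact galg_mul1l : left_id galg_one galg_mul.
Proof.
move=> a; apply/ffunP=> g; rewrite ffunE (bigD1 1%g) //= big1 => [|h /negbTE h1].
  by rewrite ffunE eqxx mul1r invg1 mul1g addr0.
by rewrite ffunE h1 mul0r.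
Qed.

Fact galg_mul1r : right_id galg_one galg_mul.
Proof.
move=> a; apply/ffunP=> g; rewrite ffunE (bigD1 g) //= big1 => [|h hg].
  by rewrite ffunE mulVg eqxx mulr1 addr0.
by rewrite ffunE -eq_mulVg1 (negbTE hg) mulr0.
Qed.

Fact galg_mulDl : left_distributive galg_mul +%R.
Proof.
move=> a b c; apply/ffunP=> g; rewrite !ffunE -big_split /=.
by apply: eq_bigr => h _; rewrite ffunE mulrDl.
Qed.

Fact galg_mulDr : right_distributive galg_mul +%R.
Proof.
move=> a b c; apply/ffunP=> g; rewrite !ffunE -big_split /=.
by apply: eq_bigr => h _; rewrite ffunE mulrDr.
Qed.

Fact galg_one_neq0 : galg_one != 0.
Proof.
by apply/eqP=> /ffunP/(_ 1%g)/eqP; rewrite !ffunE eqxx oner_eq0.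
Qed.

HB.instance Definition _ := GRing.Zmodule_isNzRing.Build KG
  galg_mulA galg_mul1l galg_mul1r galg_mulDl galg_mulDr galg_one_neq0.

Fact galg_scaleAl (k : K) (a b : KG) : k *: (a * b) = (k *: a) * b.
Proof.
apply/ffunP=> g; rewrite !ffunE /GRing.scale /= big_distrr /=.
by apply: eq_bigr => h _; rewrite ffunE mulrA.
Qed.

HB.instance Definition _ := GRing.Lmodule_isLalgebra.Build K KG galg_scaleAl.

Fact galg_scaleAr (k : K) (a b : KG) : k *: (a * b) = a * (k *: b).
Proof.
apply/ffunP=> g; rewrite !ffunE /GRing.scale /= big_distrr /=.
by apply: eq_bigr => h _; rewrite ffunE mulrCA.
Qed.

HB.instance Definition _ := GRing.Lalgebra_isAlgebra.Build K KG galg_scaleAr.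

End GroupAlgebra.

Section Structure.
Variable K : fieldType.

(* A is isomorphic, as a K-algebra, to the product of the B i: its components *)
(* p i are K-algebra morphisms and together they form a bijection.            *)
Definition direct_sum (A : algType K) (I : finType) (B : I -> algType K) :=
  exists p : forall i, {lrmorphism A -> B i},
    bijective (fun a : A => [ffun i => p i a] : {dffun forall i, B i}).

Definition two_sided_ideal (A : nzRingType) (J : A -> Prop) :=
  [/\ J 0, (forall a b, J a -> J b -> J (a - b))
    & forall a b, J b -> J (a * b) /\ J (b * a)].

(* Nontriviality of the ring is part of nzRingType. *)
Definition simple_ring (A : nzRingType) :=
  forall J : A -> Prop, two_sided_ideal J ->
    (forall a, J a -> a = 0) \/ (forall a, J a).

Definition wedderburn_decomposition
    (A : algType K) (I : finType) (B : I -> algType K) :=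
  (forall i, simple_ring (B i)) /\ direct_sum A B.

(* An isomorphism of K-algebras from B to D, where D is an algebra over an    *)
(* extension L of K and K acts on D through L.                                *)
Definition isomorphic_over (L : fieldExtType K) (B : algType K)
    (D : algType L) :=
  exists phi : {lrmorphism B -> D | GRing.in_alg L \; *:%R}, bijective phi.

(* The centre of D is exactly L. *)
Definition central (L : fieldType) (D : algType L) :=
  forall z : D, (forall a, z * a = a * z) -> exists c : L, z = c%:A.

Definition quaternion_algebra (B : algType K) :=
  exists (L : fieldExtType K) (D : falgType L),
    [/\ central D, simple_ring D, \dim {:D} = 4%N & isomorphic_over B D].

Definition matrix_ring2 (B : algType K) :=
  exists L : fieldExtType K, isomorphic_over B 'M[L]_2.

Definition sum_family (a b : nat) (F : 'I_a -> fieldExtType K)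
    (Q : 'I_b -> algType K) (i : 'I_a + 'I_b) : algType K :=
  match i with inl j => F j | inr j => Q j end.

Definition fields_and_quaternions (A : algType K) (a b : nat)
    (F : 'I_a -> fieldExtType K) (Q : 'I_b -> algType K) :=
  (forall j, quaternion_algebra (Q j)) /\ direct_sum A (sum_family F Q).

End Structure.

(* Since the presented group is finite, the library predicate \isog Grp,      *)
(* which speaks of the largest finite quotient, says that gT is this group.   *)
Definition type_D2 (m : nat) (gT : finGroupType) :=
  ([set: gT] \isog Grp (x : y : t :
     t ^+ (2 ^ m)%N, x ^+ 2 = y ^+ 2 = t, [~ t, x], [~ t, y],
     [~ x, y] = t ^+ (2 ^ m.-1)%N))%g.

(* Main.v *)
(* Over a field K of characteristic not 2, every irreducible factor p of      *)
(* X^(2^m) - 1 and every sign give a morphism from KG to L = K[X]/(p) with    *)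
(* x |-> X and y |-> +-X, while every irreducible factor r of X^(2^(m-1)) + 1 *)
(* with root T in L = K[X]/(r) gives a morphism to M_2(L): i = T^(2^(m-2))    *)
(* satisfies i^2 = -1, so that the matrices x |-> (0, T; 1, 0) and            *)
(* y |-> (0, -iT; i, 0) anticommute and both square to T.  These morphisms    *)
(* are surjective, pairwise separated and jointly injective, hence KG is the  *)
(* direct sum of their targets, and counting components amounts to counting   *)
(* irreducible factors.  Over Q each X^(2^k) + 1 is irreducible.  Over a      *)
(* finite field one of -1, 2, -2 is a square, so that X^(2^k) + 1 splits into *)
(* two factors of equal degree for k >= 2; when q = 3 mod 8 the order of q    *)
(* modulo 2^(k+1) is 2^(k-1) and these two factors are irreducible.           *)

(* Conceptually, the commutator z = x^(2^m) is a central involution, so in characteristic not 2 the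
   idempotents (1+z)/2 and (1-z)/2 cut KG in two. Where z = 1, the algebra is that of the abelian
   quotient: K[X,Y]/(X^(2^m) - 1, Y^2 - X^2), in which Y = X or Y = -X, so each irreducible factor
   of X^(2^m) - 1 counts twice. Where z = -1, x and y anticommute and t satisfies T^(2^(m-1)) = -1;
   each irreducible factor of that equation gives one quaternion algebra, split because -1 is a
   square in its centre.

   As X^(2^m) - 1 is X - 1 times the product of X^(2^k) + 1 for k < m, let l_k be the number of
   irreducible factors of X^(2^k) + 1. There are 2(1 + l_0 + ... + l_(m-1)) fields and l_(m-1)
   quaternion algebras. Over the rationals every l_k is 1 ([rat_X2n_add1_irreducible]). Over a
   finite field of odd order l_k is at least 2 for k >= 2, with l_0 = l_1 = 1 and l_k = 2 when q = 3
   mod 8 ([finite_X2n_add1_factorization]); this gives the bound 2(2m-1) + 2 = 4m.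

   [type_D2_d2group] replaces the presented group by a concrete model, [d2_separating] builds the
   components, and [separating_direct_sum] turns them into a direct sum. [separating_card_leq]
   carries the lower bound over to an arbitrary Wedderburn decomposition, and
   [finite_quaternion_matrix_ring2] shows that every quaternion algebra over a finite field is a
   matrix ring. *)
From HB Require Import structures.
Require Import Defs.
From mathcomp Require Import all_boot all_order all_algebra all_fingroup.
From mathcomp Require Import all_solvable all_field.
From mathcomp Require Import ring zify.
From Stdlib Require Import Classical_Prop.

Set Implicit Arguments.
Unset Strict Implicit.
Unset Printing Implicit Defensive.

Import GRing.Theory.

(** * The group of type D_2 *)

(* With m = n + 1, the pair (k, e) stands for x^k y^e, where x has order      *)
(* 2^(m+1), y^2 = x^2 and y x^l = x^l (x^(2^m))^l y.                          *)
Definition d2group (n : nat) : Type := ('Z_(2 ^ n.+2) * bool)%type.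

Section D2Group.
Local Open Scope ring_scope.
Variable n : nat.
Local Notation H := (d2group n).
Local Notation m := n.+1.
Local Notation N := (2 ^ m.+1)%N.
Implicit Types (a b : 'Z_N) (e : bool).

HB.instance Definition _ := Finite.copy H ('Z_N * bool)%type.

Definition d2comm : 'Z_N := (2 ^ m)%:R.

Lemma d2_order_gt1 : (1 < N)%N.
Proof. by rewrite expnS; have := expn_gt0 2 m; lia. Qed.

Lemma d2comm_double : d2comm + d2comm = 0.
Proof. by rewrite -natrD addnn -mul2n -expnS pchar_Zp ?d2_order_gt1. Qed.

Lemma d2comm_sqr : d2comm * d2comm = 0.
Proof.
have le_m : (m.+1 <= m + m)%N by lia.
rewrite -natrM -expnD -(subnKC le_m).
by rewrite expnD natrM pchar_Zp ?mul0r ?d2_order_gt1.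
Qed.

Definition d2mul (u v : H) : H :=
  (u.1 + v.1 + (if u.2 then d2comm * v.1 + (if v.2 then 2 else 0) else 0),
   u.2 (+) v.2).
Definition d2one : H := (0, false).
Definition d2inv (u : H) : H :=
  (- u.1 - (if u.2 then 2 + d2comm * u.1 else 0), u.2).

Lemma d2mulA : associative d2mul.
Proof.
move=> [a [|]] [b [|]] [c e]; rewrite /d2mul /=; congr pair;
  try by case: e => //=; ring.
(* The two bracketings differ by (z+z)(c+q) + z^2 c, which vanishes because z is 2^m modulo
   2^(m+1). *)
set z := d2comm; pose q : 'Z_N := if e then 1 else 0.
transitivity (a + b + (z * b + 2) + c + 0 + ((z + z) * (c + q) + z * z * c)).
  by rewrite /q; case: e {q} => /=; ring.
by rewrite /z d2comm_double d2comm_sqr !mul0r !addr0.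
Qed.

Lemma d2mul1 : left_id d2one d2mul.
Proof. by move=> [a e]; rewrite /d2mul /= add0r addr0. Qed.

Lemma d2mulV : left_inverse d2one d2inv d2mul.
Proof.
move=> [a [|]]; rewrite /d2mul /d2inv /d2one /=; congr pair; ring.
Qed.

HB.instance Definition _ := Finite_isGroup.Build H d2mulA d2mul1 d2mulV.

End D2Group.

Section D2Presentation.
Local Open Scope group_scope.
Implicit Types gT : finGroupType.

(* The presentation, with the redundant generator t eliminated. *)
Lemma type_D2_presentation m gT (G : {group gT}) : (0 < m)%N ->
  reflect (exists x y, [/\ x ^+ (2 ^ m.+1) = 1, y ^+ 2 = x ^+ 2,
             [~ x, y] = x ^+ (2 ^ m) & <[x]> <*> <[y]> = G])
    (G \homg Grp (x : y : t :
       t ^+ (2 ^ m)%N, x ^+ 2 = y ^+ 2 = t, [~ t, x], [~ t, y],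
       [~ x, y] = t ^+ (2 ^ m.-1)%N)).
Proof.
case: m => // m _; have eS k : (2 * 2 ^ k = 2 ^ k.+1)%N by rewrite -expnS.
apply: (iffP existsP) => [[[[x y] t]] | [x [y [x1 yx cxy defG]]]] /=.
  rewrite !xpair_eqE => /and5P[/eqP defG /eqP t1 /eqP xt /eqP yt].
  case/and3P=> _ _ /eqP cxy; exists x, y; split.
  - by rewrite -eS expgM xt.
  - by rewrite xt yt.
  - by rewrite cxy -xt -expgM eS.
  rewrite -defG -xt; apply/esym/joing_idPl.
  by rewrite cycle_subG mem_gen // inE groupX ?cycle_id.
exists (x, y, x ^+ 2); rewrite /= !xpair_eqE yx -!expgM !eS x1 cxy !eqxx /=.
apply/and3P; split.
- rewrite -defG; apply/eqP/joing_idPl.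
  by rewrite cycle_subG mem_gen // inE groupX ?cycle_id.
- by apply/commgP/commute_sym/commuteX.
- by rewrite andbT -yx; apply/commgP/commute_sym/commuteX.
Qed.

(** Since y normalizes <x> and y^2 lies in <x>, the group is the union of <x> and a single further
    coset. *)
Lemma card_type_D2 m gT (G : {group gT}) x y : (0 < m)%N ->
    x ^+ (2 ^ m.+1) = 1 -> y ^+ 2 = x ^+ 2 -> [~ x, y] = x ^+ (2 ^ m) ->
  <[x]> <*> <[y]> = G -> (#|G| <= 2 ^ m.+2)%N.
Proof.
move=> m_gt0 x1 yx cxy <-.
have nxy : <[y]> \subset 'N(<[x]>).
  rewrite cycle_subG; apply/normP/eqP.
  rewrite eqEcard cardJg leqnn andbT -cycleJ cycle_subG.
  by rewrite conjg_mulR cxy groupM ?groupX ?cycle_id.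
rewrite norm_joinEr //.
have sub : <[x]> * <[y]> \subset <[x]> * [set 1; y].
  apply/subsetP=> _ /mulsgP[a _ xa /cycleP[k ->] ->].
  rewrite -(odd_double_half k) addnC expgD -mul2n expgM yx mulgA mem_mulg //.
    by rewrite groupM ?groupX ?cycle_id.
  by case: (odd k); rewrite !inE ?expg1 ?expg0 eqxx ?orbT.
apply: leq_trans (subset_leq_card sub) _.
rewrite mulgU; apply: leq_trans (leq_card_setU _ _) _.
rewrite !card_rcoset addnn -mul2n expnS leq_mul //.
by rewrite dvdn_leq ?expn_gt0 // order_dvdn x1.
Qed.

Variable n : nat.
Local Notation H := (d2group n).
Local Notation m := n.+1.

Definition d2x : H := (1%R, false).
Definition d2y : H := (0%R, true).

Lemma d2mulE (u v : H) : u * v = d2mul u v. Proof. by []. Qed.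

Lemma d2x_exp k : d2x ^+ k = (k%:R%R, false) :> H.
Proof.
elim: k => // k IH; rewrite expgS IH d2mulE /d2mul /= addr0.
by rewrite -natr1 addrC.
Qed.

Lemma d2_normal_form (u : H) : u = d2x ^+ u.1 * d2y ^+ u.2.
Proof.
case: u => k e; rewrite d2x_exp natr_Zp /= d2mulE /d2mul.
by case: e => /=; rewrite !addr0.
Qed.

Lemma card_d2group : #|{: H}| = (2 ^ m.+2)%N.
Proof.
rewrite card_prod card_bool card_ord Zp_cast ?d2_order_gt1 //.
by rewrite -expnSr.
Qed.

(** The model satisfies the relations, so it is an image of [gT]; as [gT] has at most 2^(m+2)
    elements and the model exactly that many, the surjection is bijective. *)
Lemma type_D2_d2group gT : type_D2 m gT ->
  exists2 f : gT -> H, bijective f & {morph f : g h / g * h}.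
Proof.
move=> isoG.
have [] : [set: H] \homg [set: gT]; last first.
  have /type_D2_presentation[//|x [y [x1 yx cxy defG]]] := isoGrp_hom isoG.
  have cG := card_type_D2 (ltn0Sn n) x1 yx cxy defG.
  move=> /homgP[f imf].
  exists f => [|g h]; last by rewrite morphM ?inE.
  have imT : f @: [set: gT] = [set: H].
    by rewrite -imf morphimEdom.
  have injf : injective f.
    have: {in [set: gT] &, injective f}.
      apply/imset_injP; rewrite eqn_leq leq_imset_card imT.
      by rewrite (cardsT H) card_d2group.
    by move=> inj g h; apply: inj; rewrite inE.
  apply: (inj_card_bij injf).
  by rewrite -(cardsT H) -(cardsT gT) -imT leq_imset_card.
rewrite isoG; apply/type_D2_presentation => //; exists d2x, d2y; split.
- by rewrite d2x_exp pchar_Zp ?d2_order_gt1.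
- by rewrite d2x_exp expgS expg1 d2mulE /d2mul /= mulr0 !add0r.
- apply: (mulgI (d2y * d2x)); rewrite -commgC d2x_exp !d2mulE /d2mul /=.
  congr pair; set z := d2comm n; rewrite -/z.
  transitivity (1 + (z + z) + z * z)%R; last by rewrite /z /d2comm; ring.
  by rewrite d2comm_double d2comm_sqr /= !addr0.
apply/eqP; rewrite -subTset; apply/subsetP=> u _; rewrite (d2_normal_form u).
by rewrite groupM // mem_gen // inE mem_cycle ?orbT.
Qed.

End D2Presentation.

(** * Direct sums *)

Section DirectSum.
Local Open Scope ring_scope.
Variables (K : fieldType) (A : algType K).

(** These are the hypotheses of the Chinese remainder theorem, with the comaximality of two kernels
    expressed by an element [c]. *)
Definition separating (I : finType) (B : I -> algType K)
    (p : forall i, {lrmorphism A -> B i}) :=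
  [/\ forall i b, exists a, p i a = b,
      forall i j, i != j -> exists c, p i c = 1 /\ p j c = 0
    & forall a, (forall i, p i a = 0) -> a = 0].

Lemma separating_reindex (I J : finType) (B : I -> algType K)
    (p : forall i, {lrmorphism A -> B i}) (f : J -> I) :
  bijective f -> separating p -> separating (fun j => p (f j)).
Proof.
move=> bij_f [surj sep inj]; split=> [j | j k jk | a a0]; first exact: surj.
- by apply: sep; rewrite (inj_eq (bij_inj bij_f)).
- by have [g _ fK] := bij_f; apply: inj => i; rewrite -(fK i).
Qed.

Section Separating.
Variables (I : finType) (B : I -> algType K).
Variable p : forall i, {lrmorphism A -> B i}.
Hypothesis sep_p : separating p.

(** Such an [e] is the product over k != i of elements sent to 1 by [p i] and to 0 by [p k]. *)
Lemma separating_idempotent i : exists e, forall j, p j e = (j == i)%:R.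
Proof.
have [_ sep _] := sep_p.
suff [e [e1 e0]] : exists e, p i e = 1 /\
    {in enum I, forall j, j != i -> p j e = 0}.
  exists e => j; have [->|ji] := eqVneq j i; first by rewrite e1.
  by rewrite e0 ?mem_enum.
elim: (enum I) => [|k s [e [e1 e0]]]; first by exists 1; rewrite rmorph1.
have [ki|ki] := eqVneq k i.
  exists e; split=> // j; rewrite inE => /predU1P[->|]; last exact: e0.
  by rewrite ki eqxx.
have /sep[c [c1 c0]] : i != k by rewrite eq_sym.
exists (c * e); split=> [|j]; first by rewrite rmorphM /= c1 e1 mulr1.
rewrite inE => /predU1P[-> _|js ji]; first by rewrite rmorphM /= c0 mul0r.
by rewrite rmorphM /= e0 ?mulr0.
Qed.

Lemma separating_inj a b : (forall i, p i a = p i b) -> a = b.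
Proof.
have [_ _ inj] := sep_p => eq_ab; apply/subr0_eq/inj => i.
by rewrite rmorphB /= eq_ab subrr.
Qed.

Lemma separating_direct_sum : direct_sum A B.
Proof.
exists p; set F : A -> {dffun forall i, B i} := fun a => _.
have [surj _ _] := sep_p.
have injF : injective F.
  move=> a b eqF; apply: separating_inj => i.
  have := congr1 (fun d : {dffun forall i, B i} => d i) eqF.
  by rewrite !ffunE.
have surjF (d : {dffun forall i, B i}) : exists a, F a == d.
  have [a Da] := fin_all_exists (fun i => surj i (d i)).
  have [e De] := fin_all_exists separating_idempotent.
  exists (\sum_i a i * e i); apply/eqP/ffunP=> i; rewrite ffunE rmorph_sum /=.
  rewrite (bigD1 i) //= rmorphM /= De eqxx Da mulr1 big1 ?addr0 // => j ji.
  by rewrite rmorphM /= De eq_sym (negbTE ji) mulr0.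
exists (fun d => xchoose (surjF d)) => [a | d];
  last exact: (eqP (xchooseP (surjF d))).
by apply: injF; apply: (eqP (xchooseP (surjF (F a)))).
Qed.

(** The elements fixed by multiplication by [e] form a two-sided ideal containing [e], hence
    containing 1. *)
Lemma simple_central_idempotent (C : nzRingType) (e : C) : simple_ring C ->
  (forall b, e * b = b * e) -> e * e = e -> e != 0 -> e = 1.
Proof.
move=> simC ce ee e0; have [|J0|/(_ 1)] := simC (fun b => b * e = b);
  last by rewrite mul1r.
  split=> [|a b Ja Jb|a b Jb]; first exact: mul0r.
    by rewrite mulrBl Ja Jb.
  by rewrite -mulrA Jb -mulrA -ce mulrA Jb.
by rewrite (J0 e ee) eqxx in e0.
Qed.

(* The idempotents of the components B i stay central, orthogonal and nonzero *)
(* in A, and a simple ring has no central idempotent besides 0 and 1.         *)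
Lemma separating_card_leq (J : finType) (C : J -> algType K) :
  wedderburn_decomposition A C -> (#|I| <= #|J|)%N.
Proof.
case=> simC [q [q' qK q'K]].
have surj_q j (b : C j) : exists a, q j a = b.
  exists (q' [ffun k => dfwith (fun k => 0 : C k) b k]).
  have := congr1 (fun d : {dffun forall j, C j} => d j)
    (q'K [ffun k => dfwith (fun k => 0 : C k) b k]).
  by rewrite !ffunE dfwith_in.
have [e De] := fin_all_exists separating_idempotent.
have ce i a : e i * a = a * e i.
  apply: separating_inj => j; rewrite !rmorphM /= !De.
  by case: (j == i); rewrite ?mul0r ?mulr0 ?mul1r ?mulr1.
have ee i k : e i * e k = (i == k)%:R * e i.
  apply: separating_inj => j; rewrite !rmorphM /= !De rmorph_nat -!natrM !mulnb.
  by have [-> | ji] := eqVneq j i; rewrite ?andbF // andbT.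
have nz_e i : exists j, q j (e i) != 0.
  apply/existsP; rewrite -[X in is_true X]negbK negb_exists.
  apply/negP=> /forallP q0.
  have ei0 : e i = 0.
    apply: (can_inj qK); apply/ffunP=> j; rewrite !ffunE rmorph0.
    exact: (eqP (negPn (q0 j))).
  by have := De i i; rewrite ei0 eqxx rmorph0 => /esym/eqP; rewrite oner_eq0.
have [f Df] := fin_all_exists nz_e.
have q1 i : q (f i) (e i) = 1.
  apply: simple_central_idempotent => // [b||]; last exact: Df.
    by have [a <-] := surj_q _ b; rewrite -!rmorphM ce.
  by rewrite -rmorphM ee eqxx mul1r.
(* If two distinct idempotents were nonzero in the same simple component, both would equal 1 there,
   although their product is 0. *)
suff: injective f by apply: leq_card.
move=> i k eq_f; apply/eqP/negPn/negP => ik.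
have := q1 k; rewrite -eq_f => q1k.
have: q (f i) (e i * e k) = 1 by rewrite rmorphM /= q1 q1k mulr1.
by rewrite ee (negbTE ik) mul0r rmorph0 /= => /esym/eqP; rewrite oner_eq0.
Qed.

End Separating.
End DirectSum.

(** * Representations of the group algebra *)

Section Lift.
Local Open Scope ring_scope.
Variables (K : fieldType) (gT : finGroupType) (B : algType K) (f : gT -> B).
Local Notation KG := (group_algebra K gT).

Definition galg_gen (g : gT) : KG := [ffun h => (h == g)%:R : K^o].

Lemma galg_genM g h : galg_gen (g * h)%g = galg_gen g * galg_gen h.
Proof.
apply/ffunP=> k; rewrite !ffunE (bigD1 g) //= big1 => [|l /negbTE lg].
  by rewrite !ffunE eqxx mul1r addr0 -(inj_eq (mulgI g^-1%g)) mulKg.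
by rewrite !ffunE lg mul0r.
Qed.

Lemma galg_gen1 : galg_gen 1%g = 1. Proof. by []. Qed.

Lemma galg_sum_gen (a : KG) : a = \sum_g (a g : K) *: galg_gen g.
Proof.
apply/ffunP=> h; rewrite sum_ffunE (bigD1 h) //= big1 => [|g /negbTE gh].
  by rewrite !ffunE eqxx addr0 [RHS]mulr1.
by rewrite !ffunE eq_sym gh [LHS]mulr0.
Qed.

Hypotheses (f1 : f 1%g = 1) (fM : {morph f : g h / (g * h)%g >-> g * h}).

(* The proofs are arguments only to key the morphism structures below.        *)
Definition galg_lift (_ : f 1%g = 1)
  (_ : {morph f : g h / (g * h)%g >-> g * h}) (a : KG) : B :=
  \sum_g (a g : K) *: f g.
Local Notation lift := (galg_lift f1 fM).

Fact galg_lift_linear : linear lift.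
Proof.
move=> k a b; rewrite /galg_lift scaler_sumr -big_split /=.
by apply: eq_bigr => g _; rewrite !ffunE scalerDl scalerA.
Qed.

HB.instance Definition _ := GRing.isLinear.Build K KG B *:%R lift
  galg_lift_linear.

Lemma galg_lift_gen g : lift (galg_gen g) = f g.
Proof.
rewrite /galg_lift (bigD1 g) //= big1 => [|h /negbTE hg].
  by rewrite ffunE eqxx scale1r addr0.
by rewrite ffunE hg scale0r.
Qed.

Fact galg_lift_monoid : monoid_morphism lift.
Proof.
split=> [|a b]; first by rewrite -galg_gen1 galg_lift_gen.
rewrite [a in LHS]galg_sum_gen [b in LHS]galg_sum_gen mulr_suml raddf_sum.
rewrite [lift a]/galg_lift mulr_suml; apply: eq_bigr => g _.
rewrite mulr_sumr raddf_sum /galg_lift mulr_sumr; apply: eq_bigr => h _.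
rewrite -scalerAl -!scalerAr -scalerAl -galg_genM.
have liftZ k c : lift (k *: c) = k *: lift c by rewrite linearZ.
by rewrite /= !liftZ galg_lift_gen fM !scalerA [in LHS]mulrC.
Qed.

HB.instance Definition _ := GRing.isMonoidMorphism.Build KG B lift
  galg_lift_monoid.

End Lift.

(** * Representations of the group of type D_2 *)

Section D2Rep.
Local Open Scope ring_scope.
Variable n : nat.
Local Notation m := n.+1.
Local Notation N := (2 ^ m.+1)%N.

Definition d2_relations (B : nzRingType) (X Y : B) :=
  [/\ X ^+ N = 1, Y ^+ 2 = X ^+ 2 & Y * X = X ^+ (2 ^ m) * (X * Y)].

Section Rep.
Variables (B : nzRingType) (X Y : B).
Hypothesis relXY : d2_relations X Y.

Definition d2rep (u : d2group n) : B := X ^+ u.1 * Y ^+ u.2.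

Lemma d2repE k e : d2rep (k%:R, e) = X ^+ k * Y ^+ e.
Proof.
have [XN _ _] := relXY.
have kN : (k%:R : 'Z_N) = (k %% N)%N :> nat by rewrite val_Zp_nat ?d2_order_gt1.
by rewrite /d2rep -[X ^+ _]/(X ^+ (k%:R : 'Z_N)) kN expr_mod.
Qed.

Lemma d2rep_commute l : Y * X ^+ l = X ^+ (2 ^ m * l + l) * Y.
Proof.
have [_ _ cXY] := relXY.
elim: l => [|l IH]; first by rewrite muln0 !expr0 mulr1 mul1r.
rewrite exprSr mulrA IH -mulrA cXY !mulrA -!exprD -exprSr.
by congr (X ^+ _ * _); lia.
Qed.

Lemma d2repM u v : d2rep (u * v)%g = d2rep u * d2rep v.
Proof.
have [_ YX _] := relXY.
case: u v => [a d] [b e]; rewrite d2mulE -[a]natr_Zp -[b]natr_Zp.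
move: (val a) (val b) => {a b} k l.
have ->: d2mul (k%:R, d) (l%:R, e) = ((k + l + (if d then
    2 ^ m * l + (if e then 2 else 0) else 0))%N%:R, d (+) e) :> d2group n.
  by rewrite /d2mul /d2comm; case: d e => [] []; rewrite !(natrD, natrM).
rewrite !d2repE mulrA -[X ^+ k * _ * _]mulrA.
case: d => /=; last by rewrite addn0 mul1r exprD.
rewrite expr1 d2rep_commute; case: e => /=; last first.
  by rewrite expr0 mulr1 mulrA -exprD; congr (X ^+ _ * _); lia.
rewrite expr0 expr1 mulr1 -!mulrA -expr2 YX -!exprD.
by congr (X ^+ _); lia.
Qed.

End Rep.

Variables (K : fieldType) (gT : finGroupType) (phi : gT -> d2group n).
Variable psi : d2group n -> gT.
Hypotheses (phiK : cancel phi psi) (psiK : cancel psi phi).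
Hypothesis phiM : {morph phi : g h / (g * h)%g}.
Local Notation KG := (group_algebra K gT).

Definition galg_x : KG := galg_gen K (psi (d2x n)).
Definition galg_y : KG := galg_gen K (psi (d2y n)).

Lemma d2_psiM : {morph psi : u v / (u * v)%g}.
Proof. by move=> u v; apply: (can_inj phiK); rewrite phiM !psiK. Qed.

Lemma d2_psi1 : psi 1%g = 1%g.
Proof. by apply: (mulgI (psi 1%g)); rewrite -d2_psiM !mulg1. Qed.

Lemma galg_genX u k : galg_gen K (psi (u ^+ k)%g) = galg_gen K (psi u) ^+ k.
Proof.
elim: k => [|k IH]; first by rewrite d2_psi1 galg_gen1.
by rewrite expgS d2_psiM galg_genM IH exprS.
Qed.

Lemma galg_d2rep u : galg_gen K (psi u) = d2rep galg_x galg_y u.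
Proof.
by rewrite [in LHS](d2_normal_form u) d2_psiM galg_genM !galg_genX.
Qed.

Lemma galg_d2_relations : d2_relations galg_x galg_y.
Proof.
split; rewrite -?galg_genX -?galg_genM -?d2_psiM.
- by rewrite d2x_exp pchar_Zp ?d2_order_gt1 // [X in psi X](_ : _ = 1%g)
  ?d2_psi1.
- congr (galg_gen _ (psi _)).
  by rewrite d2x_exp expgS expg1 d2mulE /d2mul /= mulr0 !add0r.
- congr (galg_gen _ (psi _)); rewrite d2x_exp !d2mulE /d2mul /=.
  by congr pair; rewrite /d2comm mulr1 !(addr0, add0r) addrC.
Qed.

Lemma galg_d2_lift (B : algType K) (X Y : B) : d2_relations X Y ->
  exists q : {lrmorphism KG -> B}, q galg_x = X /\ q galg_y = Y.
Proof.
move=> relXY; pose f g := d2rep X Y (phi g).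
have f1 : f 1%g = 1 by rewrite -d2_psi1 /f psiK /d2rep mulr1.
have fM : {morph f : g h / (g * h)%g >-> g * h}.
  by move=> g h; rewrite /f phiM (d2repM relXY).
exists (galg_lift f1 fM : {lrmorphism KG -> B}).
rewrite /= !galg_lift_gen /f !psiK.
by split; [rewrite (d2repE relXY 1) mulr1 | rewrite (d2repE relXY 0) mul1r].
Qed.

(** The size bounds allow [f] and [g] to be proved zero by showing that X^N - 1 divides them. *)
Lemma galg_d2_poly (a : KG) : exists f g : {poly K},
  [/\ (size f <= N)%N, (size g <= N)%N
    & a = horner_alg galg_x f + horner_alg galg_x g * galg_y].
Proof.
pose c e : {poly K} := \sum_(k : 'Z_N) (a (psi (k, e)) : K) *: 'X^k.
have size_c e : (size (c e) <= N)%N.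
  apply: leq_trans (size_sum _ _ _) _; apply/bigmax_leqP=> k _.
  apply: leq_trans (size_scale_leq _ _) _; rewrite size_polyXn.
  by rewrite -[X in (_ < X)%N](Zp_cast (d2_order_gt1 n)) ltn_ord.
have alg_c e : horner_alg galg_x (c e) =
    \sum_(k : 'Z_N) (a (psi (k, e)) : K) *: galg_x ^+ k.
  rewrite raddf_sum /=; apply: eq_bigr => k _.
  by rewrite linearZ /= rmorphXn /= (horner_algX galg_x) mulr_algl.
exists (c false), (c true); split=> //; rewrite [LHS]galg_sum_gen.
rewrite (reindex psi); last by exists phi => u _.
pose F k e := (a (psi (k, e)) : K) *: galg_gen K (psi (k, e)).
transitivity (\sum_(k : 'Z_N) \sum_(e : bool) F k e).
  by rewrite pair_bigA; apply: eq_bigr => -[].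
rewrite exchange_big big_bool !alg_c mulr_suml /= [RHS]addrC; congr (_ + _).
  by apply: eq_bigr => k _; rewrite /F galg_d2rep /d2rep /= expr1 scalerAl.
by apply: eq_bigr => k _; rewrite /F galg_d2rep /d2rep /= expr0 mulr1.
Qed.

End D2Rep.

(** * Restriction of scalars and matrix algebras *)

(** The alias lets the ring [D] carry a K-algebra structure, k acting as [k%:A], apart from its
    L-algebra structure; matrix rings over L can then serve as targets of morphisms from KG. *)
Definition restrict_scalars (K : fieldType) (L : fieldExtType K)
  (D : algType L) : Type := D.

Section Restrict.
Local Open Scope ring_scope.
Variables (K : fieldType) (L : fieldExtType K) (D : algType L).
Local Notation R := (restrict_scalars D).

HB.instance Definition _ := GRing.NzRing.on R.

Definition restrict_scale (k : K) (v : R) : R := (k%:A : L) *: (v : D).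

Fact restrict_scaleA a b v :
  restrict_scale a (restrict_scale b v) = restrict_scale (a * b) v.
Proof. by rewrite /restrict_scale scalerA -in_algE -rmorphM. Qed.

Fact restrict_scale1 : left_id 1 restrict_scale.
Proof. by move=> v; rewrite /restrict_scale !scale1r. Qed.

Fact restrict_scaleDr : right_distributive restrict_scale +%R.
Proof. by move=> a u v; rewrite /restrict_scale scalerDr. Qed.

Fact restrict_scaleDl v : {morph restrict_scale^~ v : a b / a + b}.
Proof. by move=> a b; rewrite /restrict_scale !scalerDl. Qed.

HB.instance Definition _ := GRing.Zmodule_isLmodule.Build K R
  restrict_scaleA restrict_scale1 restrict_scaleDr restrict_scaleDl.

Fact restrict_scaleAl (k : K) (u v : R) : k *: (u * v) = (k *: u) * v.
Proof. exact: (@scalerAl L D). Qed.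

HB.instance Definition _ := GRing.Lmodule_isLalgebra.Build K R restrict_scaleAl.

Fact restrict_scaleAr (k : K) (u v : R) : k *: (u * v) = u * (k *: v).
Proof. exact: (@scalerAr L D). Qed.

HB.instance Definition _ := GRing.Lalgebra_isAlgebra.Build K R restrict_scaleAr.

Definition restrict_id (v : R) : D := v.

Fact restrict_id_additive : zmod_morphism restrict_id. Proof. by []. Qed.
Fact restrict_id_scalable :
  scalable_for (GRing.in_alg L \; *:%R) restrict_id.
Proof. by []. Qed.
Fact restrict_id_monoid : monoid_morphism restrict_id. Proof. by []. Qed.

HB.instance Definition _ := GRing.isZmodMorphism.Build R D restrict_id
  restrict_id_additive.
HB.instance Definition _ := GRing.isScalable.Build K R D
  (GRing.in_alg L \; *:%R) restrict_id restrict_id_scalable.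
HB.instance Definition _ := GRing.isMonoidMorphism.Build R D restrict_id
  restrict_id_monoid.

Lemma restrict_isomorphic : isomorphic_over R D.
Proof.
exists (restrict_id : {lrmorphism R -> D | GRing.in_alg L \; *:%R}).
by exists id.
Qed.

End Restrict.

Lemma simple_ring_intro (C : nzRingType) :
  (forall J : C -> Prop, two_sided_ideal J ->
     forall a, J a -> a != 0%R -> J 1%R) -> simple_ring C.
Proof.
move=> J1 J idJ; have [_ _ JM] := idJ.
(* Ideals are arbitrary predicates in [Prop], so this case distinction is classical. *)
have [[a [Ja a0]] | noJ] := classic (exists a, J a /\ a != 0%R).
  by right=> b; rewrite -[b]mulr1; apply: (JM b _ (J1 J idJ a Ja a0)).1.
left=> a Ja; apply/eqP/negPn/negP => a0.
by case: noJ; exists a.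
Qed.

Lemma field_simple (F : fieldType) : simple_ring F.
Proof.
apply: simple_ring_intro => J [_ _ JM] a Ja a0.
by rewrite -(mulVf a0); have [] := JM a^-1%R a Ja.
Qed.

Section Matrix2.
Local Open Scope ring_scope.
Variable L : fieldType.
Local Notation M2 := 'M[L]_2.

Lemma mulmx_delta3 (A : M2) i j k l :
  delta_mx i j * A * delta_mx k l = A j k *: delta_mx i l.
Proof.
apply/matrixP=> a b; rewrite mxE (bigD1 k) //= big1 => [|c ck].
  rewrite mxE (bigD1 j) //= big1 => [|c cj]; rewrite !mxE ?eqxx ?andbT.
    by rewrite !addr0; case: (a == i); case: (b == l);
      rewrite /= ?(mul1r, mul0r, mulr1, mulr0).
  by rewrite (negbTE cj) andbF mul0r.
by rewrite !mxE (negbTE ck) mulr0.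
Qed.

Lemma matrix2_simple : simple_ring M2.
Proof.
apply: simple_ring_intro => J [_ JB JM] a Ja a0.
have /matrix0Pn[j [k ajk]] := a0.
(* Multiplying [a] by elementary matrices on both sides moves its nonzero entry to position (i, i);
   dividing by the entry leaves the diagonal unit. *)
have Jd i : J (delta_mx i i).
  have := mulmx_delta3 a i j k i.
  move/(congr1 (fun x => (a j k)^-1%:M * x)).
  rewrite -!mulmxE mul_scalar_mx [in RHS]mul_scalar_mx scalerA mulVf // scale1r
    => <-.
  rewrite -mul_scalar_mx !mulmxE; apply: (JM _ _ _).1; apply: (JM _ _ _).2.
  exact: (JM _ _ _).1.
have -> : 1 = delta_mx 0 0 - (- delta_mx 1 1) :> M2.
  apply/matrixP=> i l; rewrite !mxE opprK.
  by case: i l => [[|[|//]] ?] [[|[|//]] ?]; rewrite /= ?addr0 ?add0r.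
apply: JB => //; rewrite -[- _]mulN1r; exact: (JM _ _ _).1.
Qed.

Lemma matrix2_central : central M2.
Proof.
move=> z cz; exists (z 0 0); apply/matrixP=> i j.
have := mulmx_delta3 z 0 i j 0; rewrite -cz -mulrA -!mulmxE mul_delta_mx_cond.
move/(congr1 (fun A : M2 => A 0 0)); rewrite !mxE eqxx mulr1 => <-.
rewrite (bigD1 0) //= big1 => [|k k0]; last by rewrite mulmxnE !mxE (negbTE k0)
  mul0rn mulr0.
by rewrite addr0 mulmxnE !mxE eqxx; case: (i == j); rewrite ?mulr0n ?mulr1n.
Qed.

End Matrix2.

Section Mx2.
Local Open Scope ring_scope.
Variable L : fieldType.

Definition mx2 (a b c d : L) : 'M[L]_2 :=
  \matrix_(i, j) if i == 0 then if j == 0 then a else b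
                 else if j == 0 then c else d.

Lemma mx2P (A : 'M[L]_2) : A = mx2 (A 0 0) (A 0 1) (A 1 0) (A 1 1).
Proof.
apply/matrixP=> i j; rewrite mxE.
by case: i j => [[|[|//]] ?] [[|[|//]] ?] /=; congr (A _ _); apply: val_inj.
Qed.

Lemma mx2_mul a b c d a' b' c' d' : mx2 a b c d * mx2 a' b' c' d' =
  mx2 (a * a' + b * c') (a * b' + b * d') (c * a' + d * c') (c * b' + d * d').
Proof. by rewrite [LHS]mx2P; congr mx2; rewrite mxE !big_ord_recl big_ord0 !mxE
  addr0. Qed.

Lemma mx2_add a b c d a' b' c' d' : mx2 a b c d + mx2 a' b' c' d' =
  mx2 (a + a') (b + b') (c + c') (d + d').
Proof. by rewrite [LHS]mx2P !mxE. Qed.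

Lemma mx2_scalar a : a%:M = mx2 a 0 0 a.
Proof. by rewrite [LHS]mx2P !mxE. Qed.

Lemma mx2_eq0 a b c d : (mx2 a b c d == 0) = [&& a == 0, b == 0, c == 0 & d ==
  0].
Proof.
apply/eqP/and4P => [A0 | [/eqP-> /eqP-> /eqP-> /eqP->]].
  by split; [have := congr1 (fun A : 'M_2 => A 0 0) A0
    | have := congr1 (fun A : 'M_2 => A 0 1) A0
    | have := congr1 (fun A : 'M_2 => A 1 0) A0
    | have := congr1 (fun A : 'M_2 => A 1 1) A0]; rewrite !mxE /= => ->.
by rewrite -mx2_scalar raddf0.
Qed.

End Mx2.

(** * Field and matrix components of the group algebra *)

Section Components.
Local Open Scope ring_scope.
Variable K : fieldType.

Lemma lrmorph_horner_alg (A B : algType K) (q : {lrmorphism A -> B}) x f :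
  q (horner_alg x f) = horner_alg (q x) f.
Proof.
elim/poly_ind: f => [|f c IH]; first by rewrite !rmorph0.
by rewrite !rmorphD !rmorphM /= !horner_algX !horner_algC IH linearZ rmorph1.
Qed.

(** If [p] does not divide [f], a Bezout relation evaluated at [z] would give 0 = 1. *)
Lemma irreducible_horner_alg (L : fieldExtType K) (p f : {poly K}) (z : L) :
  irreducible_poly p -> horner_alg z p = 0 -> (horner_alg z f == 0) = (p %| f).
Proof.
move=> irr_p pz0; apply/eqP/idP=> [fz0 | /dvdpP[g ->]]; last first.
  by rewrite rmorphM /= pz0 mulr0.
apply: contraTT (oner_neq0 L) => ndvd; rewrite negbK.
move: ndvd; rewrite -irreducible_poly_coprime // => /Bezout_eq1_coprimepP[[u
  v]] /= uv.
have := congr1 (horner_alg z) uv.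
by rewrite rmorphD !rmorphM /= pz0 fz0 !mulr0 addr0 rmorph1 eq_sym => ->.
Qed.

Lemma irreducible_adjoin (p : {poly K}) : irreducible_poly p ->
  exists (L : fieldExtType K) (z : L),
    [/\ horner_alg z p = 0, forall f, (horner_alg z f == 0) = (p %| f)
      & forall b, exists f, horner_alg z f = b].
Proof.
move=> irr_p; have [L _ [z pz0 zL]] := irredp_FAdjoin irr_p.
have {}pz0 : horner_alg z p = 0 by apply/rootP.
exists L, z; split=> // [f|b]; first exact: irreducible_horner_alg.
have /Fadjoin1_polyP[f ->] : b \in <<1; z>>%VS by rewrite zL memvf.
by exists f.
Qed.

Variables (n : nat) (gT : finGroupType) (phi : gT -> d2group n).
Local Notation m := n.+1.
Local Notation N := (2 ^ m.+1)%N.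
Variable psi : d2group n -> gT.
Hypotheses (phiK : cancel phi psi) (psiK : cancel psi phi).
Hypothesis phiM : {morph phi : g h / (g * h)%g}.
Local Notation KG := (group_algebra K gT).
Local Notation x := (galg_x K psi).
Local Notation y := (galg_y K psi).

Lemma field_component (p : {poly K}) (e : bool) :
    irreducible_poly p -> p %| 'X^(2 ^ m) - 1 ->
  exists (L : fieldExtType K) (q : {lrmorphism KG -> L}),
    [/\ forall b, exists a, q a = b,
        forall f, (q (horner_alg x f) == 0) = (p %| f)
      & q y = (-1) ^+ e * q x].
Proof.
move=> irr_p p_dvd; have [L [z [pz0 kerz surjz]]] := irreducible_adjoin irr_p.
have zm : z ^+ (2 ^ m) = 1.
  apply/eqP; rewrite -subr_eq0; move: p_dvd; rewrite -kerz.
  by rewrite rmorphB /= rmorphXn /= horner_algX rmorph1.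
have rel : d2_relations n z ((-1) ^+ e * z).
  split; first by rewrite expnSr exprM zm expr1n.
    by rewrite exprMn -exprM mulnC exprM sqrrN !expr1n mul1r.
  by rewrite zm mul1r mulrC.
have [q [qx qy]] := galg_d2_lift phiK psiK phiM rel.
exists L, q; split=> [b|f|]; last by rewrite qx qy.
  by have [f <-] := surjz b; exists (horner_alg x f);
    rewrite lrmorph_horner_alg qx.
by rewrite lrmorph_horner_alg qx kerz.
Qed.

(** Coordinates along 1, x, y, xy over polynomials in the central element t = x^2. *)
Definition galg_d2_elem (f0 f1 g0 g1 : {poly K}) : KG :=
  horner_alg (x ^+ 2) f0 + horner_alg (x ^+ 2) f1 * x
  + (horner_alg (x ^+ 2) g0 + horner_alg (x ^+ 2) g1 * x) * y.

Lemma horner_alg_comp_sqr (A : algType K) (a : A) f :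
  horner_alg a (f \Po 'X^2) = horner_alg (a ^+ 2) f.
Proof.
elim/poly_ind: f => [|g c IH]; first by rewrite comp_poly0 !rmorph0.
rewrite comp_polyD comp_polyM comp_polyX comp_polyC !rmorphD !rmorphM /= IH.
by rewrite !horner_algX !horner_algC.
Qed.

Lemma horner_alg_even_odd (A : algType K) (a : A) f :
  horner_alg a f =
    horner_alg (a ^+ 2) (even_poly f) + horner_alg (a ^+ 2) (odd_poly f) * a.
Proof.
by rewrite -[in LHS](poly_even_odd f) rmorphD rmorphM /= horner_algX
  !horner_alg_comp_sqr.
Qed.

Lemma matrix_component (r : {poly K}) : (0 < n)%N -> 2%:R != 0 :> K ->
    irreducible_poly r -> r %| 'X^(2 ^ n) + 1 ->
  exists (B : algType K) (q : {lrmorphism KG -> B}),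
    [/\ quaternion_algebra B, forall b, exists a, q a = b
      & forall f0 f1 g0 g1, (q (galg_d2_elem f0 f1 g0 g1) == 0) =
          [&& r %| f0, r %| f1, r %| g0 & r %| g1]].
Proof.
move=> n_gt0 nz2 irr_r r_dvd.
have [L [t [rt0 kert surjt]]] := irreducible_adjoin irr_r.
have tn : t ^+ (2 ^ n) = -1.
  apply/eqP; rewrite -addr_eq0; move: r_dvd; rewrite -kert.
  by rewrite rmorphD /= rmorphXn /= horner_algX rmorph1.
have nz2L : 2%:R != 0 :> L by rewrite -(rmorph_nat (in_alg L)) fmorph_eq0.
pose i := t ^+ (2 ^ n.-1).
have ii : i * i = -1 by rewrite /i -exprD addnn -mul2n -expnS prednK.
have nzt : t != 0.
  apply/eqP=> t0; move: tn; rewrite t0 expr0n expn_eq0 /= => /eqP.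
  by rewrite eq_sym oppr_eq0 oner_eq0.
have nzi : i != 0 by rewrite expf_neq0.
pose B := restrict_scalars 'M[L]_2.
pose X : B := mx2 0 t 1 0.
pose Y : B := mx2 0 (- (i * t)) i 0.
have scalB f : horner_alg (t%:M : B) f = (horner_alg t f)%:M.
  elim/poly_ind: f => [|f c IH]; first by rewrite !rmorph0.
  rewrite !rmorphD !rmorphM /= !horner_algX !horner_algC IH.
  by congr (_ + _); rewrite -[RHS]scalemx1.
have XX : X ^+ 2 = t%:M.
  by rewrite expr2 [LHS](mx2_mul 0 t 1 0) mx2_scalar; congr mx2; ring.
have Xpow k : X ^+ (2 * k) = (t ^+ k)%:M.
  by rewrite exprM XX; elim: k => [|k IH];
    rewrite ?expr0 // !exprS IH scalar_mxM.
have rel : d2_relations n X Y.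
  split.
  - by rewrite expnS Xpow expnSr exprM tn sqrrN expr1n.
  - rewrite XX expr2 [LHS](mx2_mul 0 (- (i * t)) i 0) mx2_scalar.
    by congr mx2; ring: ii.
  - rewrite expnS Xpow tn [Y * X](mx2_mul 0 (- (i * t)) i 0 0 t 1 0).
    rewrite [X * Y](mx2_mul 0 t 1 0 0 (- (i * t)) i 0) mx2_scalar.
    by rewrite [RHS]mx2_mul; congr mx2; ring.
have [q [qx qy]] := galg_d2_lift phiK psiK phiM rel.
pose h := horner_alg t.
have qE f0 f1 g0 g1 : q (galg_d2_elem f0 f1 g0 g1) =
  mx2 (h f0 + i * t * h g1) (t * h f1 - i * t * h g0)
      (h f1 + i * h g0) (h f0 - i * t * h g1).
  rewrite /galg_d2_elem !(rmorphD, rmorphM) /= !lrmorph_horner_alg rmorphXn /=.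
  rewrite qx qy XX !scalB -/h !mx2_scalar.
  by rewrite !(mx2_mul, mx2_add); congr mx2; ring.
(* The four entries in [qE] pair up as sums and differences, up to the units t and i; inverting 2
   recovers the four coordinates, both for surjectivity and for the kernel. *)
have B2 (a b : L) : a + b = 0 -> a - b = 0 -> a = 0 /\ b = 0.
  move=> abD abB; have a2 : 2%:R * a = (a + b) + (a - b) by ring.
  move/eqP: a2; rewrite abD abB addr0 mulf_eq0 (negbTE nz2L) => /eqP a0.
  by move: abD; rewrite a0 add0r.
exists B, q; split.
- exists L, 'M[L]_2; split; [exact: matrix2_central | exact: matrix2_simple |
  |].
    by rewrite dimvf.
  exact: restrict_isomorphic.
- move=> b; have [[f0 h0] [f1 h1]] := (surjt ((b 0 0 + b 1 1) / 2%:R),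
     surjt ((b 0 1 / t + b 1 0) / 2%:R)).
  have [[g0 k0] [g1 k1]] := (surjt ((b 1 0 - b 0 1 / t) / (2%:R * i)),
     surjt ((b 0 0 - b 1 1) / (2%:R * (i * t)))).
  exists (galg_d2_elem f0 f1 g0 g1); rewrite qE /h h0 h1 k0 k1 [RHS]mx2P.
  by congr mx2; field; rewrite ?nz2L ?nzt ?nzi.
- move=> f0 f1 g0 g1; rewrite qE mx2_eq0 -!kert -/h.
  apply/and4P/and4P => [[/eqP e1 /eqP e2 /eqP e3 /eqP e4] | []]; last first.
    move=> /eqP-> /eqP-> /eqP-> /eqP->.
    by rewrite !mulr0 !subr0 !addr0.
  have [-> /eqP] := B2 _ _ e1 e4; rewrite !mulf_eq0 (negbTE nzi) (negbTE nzt)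
    /= => ->.
  have e2' : h f1 - i * h g0 = 0.
    apply/eqP; move/eqP: e2; rewrite -mulrA mulrCA -mulrBr mulf_eq0.
    by rewrite (negbTE nzt).
  have [-> /eqP] := B2 _ _ e3 e2'.
  by rewrite mulf_eq0 (negbTE nzi) /= => ->; rewrite eqxx.
Qed.

End Components.

(** * The decomposition attached to a factorization *)

Section Factorization.
Local Open Scope ring_scope.
Variable K : fieldType.
Implicit Types (P : {poly K}) (s : seq {poly K}).

Definition irreducible_factorization P s :=
  (forall p, p \in s -> irreducible_poly p) /\ P %= \prod_(p <- s) p.

Lemma factorization_dvdp P s p :
  irreducible_factorization P s -> p \in s -> p %| P.
Proof.
by case=> _ eqP sp; rewrite (eqp_dvdr _ eqP) (big_rem p) //= dvdp_mulr.
Qed.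

Lemma factorization_coprimep P s (i j : 'I_(size s)) :
    separable_poly P -> irreducible_factorization P s ->
  i != j -> coprimep s`_i s`_j.
Proof.
move=> sepP [_ eqP] ij; apply: separable_coprime sepP _.
rewrite (eqp_dvdr _ eqP) (big_nth 0) big_mkord (bigD1 i) //= (bigD1 j) ?(eq_sym
  j) //=.
by rewrite mulrA dvdp_mulr.
Qed.

Lemma factorization_dvdp_all P s f :
    separable_poly P -> irreducible_factorization P s ->
  (forall p, p \in s -> p %| f) -> P %| f.
Proof.
move=> sepP [_ eqP]; rewrite (eqp_dvdl _ eqP).
have : \prod_(p <- s) p %| P by rewrite (eqp_dvdr _ eqP).
elim: s {eqP} => [|p s IH]; rewrite ?big_nil ?dvd1p // big_cons => dvP sf.
rewrite Gauss_dvdp; last exact: separable_coprime sepP dvP.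
rewrite sf ?mem_head // IH ?(dvdp_trans _ dvP) ?dvdp_mull // => q sq.
by rewrite sf // inE sq orbT.
Qed.

Lemma X2n_sub1_factor k :
  'X^(2 ^ k.+1) - 1 = ('X^(2 ^ k) - 1) * ('X^(2 ^ k) + 1) :> {poly K}.
Proof. by rewrite expnSr exprM -subr_sqr expr1n. Qed.

End Factorization.

Lemma card_eq_bijective (I J : finType) : #|I| = #|J| ->
  exists f : I -> J, bijective f.
Proof.
move=> eq_card; exists (fun i => enum_val (cast_ord eq_card (enum_rank i))).
exists (fun j => enum_val (cast_ord (esym eq_card) (enum_rank j))) => i;
  by rewrite enum_valK ?cast_ordK ?cast_ordKV enum_rankK.
Qed.

Section Assembly.
Local Open Scope ring_scope.
Variables (K : fieldType) (n : nat) (gT : finGroupType) (phi : gT -> d2group n).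
Local Notation m := n.+1.
Local Notation N := (2 ^ m.+1)%N.
Variable psi : d2group n -> gT.
Hypotheses (phiK : cancel phi psi) (psiK : cancel psi phi).
Hypothesis phiM : {morph phi : g h / (g * h)%g}.
Local Notation KG := (group_algebra K gT).
Local Notation x := (galg_x K psi).
Local Notation y := (galg_y K psi).
Hypotheses (n_gt0 : (0 < n)%N) (nz2 : 2%:R != 0 :> K).

Lemma separable_X2n_sub1 k : separable_poly ('X^(2 ^ k) - 1 : {poly K}).
Proof. by apply: separable_Xn_sub_1; rewrite natrX expf_neq0. Qed.

Lemma separable_X2n_add1 k : separable_poly ('X^(2 ^ k) + 1 : {poly K}).
Proof.
have := separable_X2n_sub1 k.+1; rewrite X2n_sub1_factor separable_mul.
by case/and3P.
Qed.

Lemma coprimep_X2n k : coprimep ('X^(2 ^ k) - 1) ('X^(2 ^ k) + 1 : {poly K}).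
Proof.
have := separable_X2n_sub1 k.+1; rewrite X2n_sub1_factor separable_mul.
by case/and3P.
Qed.

Lemma X2n_add1_comp k : ('X^(2 ^ k) + 1) \Po 'X^2 = 'X^(2 ^ k.+1) + 1 :> {poly
  K}.
Proof.
by rewrite comp_polyD comp_Xn_poly comp_polyC -exprM -expnS.
Qed.

(** With uP + vQ = 1, the value of vQ at [x] is the separating element. *)
Lemma coprimep_separation (B C : algType K) (p : {lrmorphism KG -> B})
    (q : {lrmorphism KG -> C}) (P Q : {poly K}) : coprimep P Q ->
    p (horner_alg x P) = 0 -> q (horner_alg x Q) = 0 ->
  exists c, p c = 1 /\ q c = 0.
Proof.
case/Bezout_eq1_coprimepP=> -[u v] /= uv pP qQ.
have hM f g : horner_alg x (f * g) = horner_alg x f * horner_alg x g.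
  by rewrite rmorphM.
exists (horner_alg x (v * Q)); split; last by rewrite hM rmorphM /= qQ mulr0.
have -> : horner_alg x (v * Q) = 1 - horner_alg x (u * P).
  by rewrite -[1](rmorph1 (horner_alg x)) -uv rmorphD /= addrAC subrr add0r.
by rewrite hM rmorphB rmorphM rmorph1 /= pP mulr0 subr0.
Qed.

Variables s r : seq {poly K}.
Hypothesis fact_s : irreducible_factorization ('X^(2 ^ m) - 1) s.
Hypothesis fact_r : irreducible_factorization ('X^(2 ^ n) + 1) r.

(** A field component is indexed by an irreducible factor and a sign, whence the factor 2 in the
    number of fields. *)
Lemma d2_separating :
  exists (F : 'I_(size s * 2) -> fieldExtType K) (Q : 'I_(size r) -> algType K)
      (p : forall i, {lrmorphism KG -> sum_family F Q i}),
    (forall j, quaternion_algebra (Q j)) /\ separating p.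
Proof.
have [c bij_c] : exists c : 'I_(size s * 2) -> 'I_(size s) * bool, bijective c.
  by apply: card_eq_bijective; rewrite card_prod !card_ord card_bool.
have s_dvd (i : 'I_(size s)) : s`_i %| 'X^(2 ^ m) - 1.
  by apply: factorization_dvdp fact_s _; rewrite mem_nth.
have s_irr (i : 'I_(size s)) : irreducible_poly s`_i.
  by apply: fact_s.1; rewrite mem_nth.
have r_dvd (i : 'I_(size r)) : r`_i %| 'X^(2 ^ n) + 1.
  by apply: factorization_dvdp fact_r _; rewrite mem_nth.
have r_irr (i : 'I_(size r)) : irreducible_poly r`_i.
  by apply: fact_r.1; rewrite mem_nth.
have [F /fin_all_exists[qF specF]] := fin_all_exists (fun j : 'I_(size s * 2) =>
  field_component phiK psiK phiM (c j).2 (s_irr (c j).1) (s_dvd (c j).1)).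
have [Q /fin_all_exists[qQ specQ]] := fin_all_exists (fun j : 'I_(size r) =>
  matrix_component phiK psiK phiM n_gt0 nz2 (r_irr j) (r_dvd j)).
pose p i : {lrmorphism KG -> sum_family F Q i} :=
  match i with inl j => qF j | inr j => qQ j end.
exists F, Q, p; split=> [j|]; first by have [] := specQ j.
(* [P i] at [x] is killed by component [i]. The factors in [r] are polynomials in t = x^2, which
   explains the composition. *)
pose P (i : 'I_(size s * 2) + 'I_(size r)) :=
  match i with inl j => s`_(c j).1 | inr j => r`_j \Po 'X^2 end.
have pP i : p i (horner_alg x (P i)) = 0.
  case: i => j /=; apply/eqP; first by have [_ -> _] := specF j.
  have [_ _ kerq] := specQ j; have := kerq r`_j 0 0 0.
  rewrite dvdpp !dvdp0 => /eqP; rewrite /galg_d2_elem !rmorph0 !mul0r !addr0.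
  by rewrite mul0r addr0 horner_alg_comp_sqr => ->.
have [xN _ _] := galg_d2_relations K phiK psiK phiM.
split=> [[] j b | i k ik | a a0].
- by have [surj _ _] := specF j; apply: surj.
- by have [_ surj _] := specQ j; apply: surj.
- have [copr|] := boolP (coprimep (P i) (P k)).
    exact: coprimep_separation copr (pP i) (pP k).
  have dvdQ (j : 'I_(size r)) : r`_j \Po 'X^2 %| 'X^(2 ^ m) + 1.
    by rewrite -X2n_add1_comp dvdp_comp_poly.
  case: i k ik => i [] k ik /=.
  + have [eq_ik|ne_ik] := eqVneq (c i).1 (c k).1; last first.
      rewrite (factorization_coprimep (separable_X2n_sub1 m) fact_s ne_ik).
      by [].
    move=> _; have sgn_ik : (c k).2 = ~~ (c i).2.
      have : c i != c k by rewrite (inj_eq (bij_inj bij_c)).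
      case: (c i) (c k) eq_ik => [u e] [v e'] /= ->; rewrite xpair_eqE eqxx.
      by case: e e' => [] [].
    (* Two components with the same factor and opposite signs agree on polynomials in [x]. They are
       told apart by y x^(-1), which maps to the sign; here x^(-1) is written x^(N-1). *)
    pose d : KG := (2%:R^-1 : K) *: (1 + ((-1) ^+ (c i).2 : K) *: (y * x ^+
      N.-1)).
    have qd (j : 'I__) : qF j d =
        (2%:R^-1 : K) *: (1 + ((-1) ^+ (c i).2 : K) *: ((-1) ^+ (c j).2 : F j)).
      have [_ _ qy] := specF j.
      rewrite /d linearZ rmorphD rmorph1 /= linearZ rmorphM rmorphXn /= qy.
      rewrite -mulrA -exprS prednK ?expn_gt0 // -rmorphXn xN rmorph1 mulr1.
      by [].
    exists d; rewrite !qd sgn_ik.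
    split; last by case: (c i).2; rewrite /= ?expr0 ?expr1 ?scaleN1r ?scale1r
      ?opprK ?subrr ?scaler0.
    have -> : ((-1) ^+ (c i).2 : K) *: ((-1) ^+ (c i).2 : F i) = 1.
      by case: (c i).2; rewrite /= ?expr0 ?expr1 ?scaleN1r ?scale1r ?opprK.
    by rewrite -mulr2n -scaler_nat scalerA mulVf // scale1r.
  + by rewrite (coprimep_dvdl (dvdQ k) (coprimep_dvdr (s_dvd _) (coprimep_X2n
    m))).
  + by rewrite coprimep_sym
      (coprimep_dvdl (dvdQ i) (coprimep_dvdr (s_dvd _) (coprimep_X2n m))).
  + rewrite coprimep_comp_poly //.
    exact: (factorization_coprimep (separable_X2n_add1 n) fact_r).
have [f [g [size_f size_g Da]]] := galg_d2_poly phiK psiK phiM a.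
suff [f0 g0] : 'X^N - 1 %| f /\ 'X^N - 1 %| g.
  have dvd0 (h : {poly K}) : (size h <= N)%N -> 'X^N - 1 %| h -> h = 0.
    move=> size_h dvd_h; apply/eqP; apply: contraTT size_h => h0.
    rewrite -ltnNge; apply: leq_trans (dvdp_leq h0 dvd_h).
    by rewrite size_XnsubC ?expn_gt0.
  by rewrite Da (dvd0 f) // (dvd0 g) // !rmorph0 mul0r addr0.
rewrite X2n_sub1_factor !Gauss_dvdp ?coprimep_X2n //.
(* In a field component of sign [e], y becomes (-1)^e x, so [a] becomes the value of this
   polynomial. *)
have s_all (e : bool) : 'X^(2 ^ m) - 1 %| f + (-1) ^+ e *: (g * 'X).
  apply: factorization_dvdp_all (separable_X2n_sub1 m) fact_s _ => q.
  have [c' cK c'K] := bij_c.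
  move=> /(nthP 0)[i lt_i <-]; pose j := c' (Ordinal lt_i, e).
  have [_ kerq qy] := specF j; have /= aj := a0 (inl j).
  have -> : s`_i = s`_(c j).1 by rewrite c'K.
  have hE : horner_alg x (f + (-1) ^+ e *: (g * 'X)) =
      horner_alg x f + ((-1) ^+ e : K) *: (horner_alg x g * x).
    by rewrite rmorphD /= linearZ /= rmorphM /= horner_algX mulr_algl.
  rewrite -kerq -[X in _ == X]aj Da hE !rmorphD /= linearZ !rmorphM /= qy c'K
    /=.
  by case: (e); rewrite ?expr0 ?expr1 ?scaleN1r ?scale1r ?mulN1r ?mul1r ?mulrN.
have R_all : [&& 'X^(2 ^ n) + 1 %| even_poly f, 'X^(2 ^ n) + 1 %| odd_poly f,
    'X^(2 ^ n) + 1 %| even_poly g & 'X^(2 ^ n) + 1 %| odd_poly g].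
  have r_all q : q \in r -> [&& q %| even_poly f, q %| odd_poly f,
      q %| even_poly g & q %| odd_poly g].
    move=> /(nthP 0)[i lt_i <-].
    have [_ _ <-] := specQ (Ordinal lt_i).
    rewrite -[X in _ == X](a0 (inr (Ordinal lt_i))) /= Da.
    by rewrite !(@horner_alg_even_odd K KG x).
  by apply/and4P; split; apply: factorization_dvdp_all (separable_X2n_add1 n)
    fact_r _ => q /r_all/and4P[].
have r_dvd_all (h : {poly K}) : 'X^(2 ^ n) + 1 %| even_poly h -> 'X^(2 ^ n) + 1
  %| odd_poly h ->
    'X^(2 ^ m) + 1 %| h.
  move=> he ho; rewrite -(poly_even_odd h) -X2n_add1_comp.
  by rewrite dvdp_add ?dvdp_mulr ?dvdp_comp_poly.
case/and4P: R_all => fe fo ge go; rewrite !r_dvd_all // !andbT.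
(* The sum and difference of f + gX and f - gX are 2f and 2gX; 2 is invertible and X is coprime to
   X^(2^m) - 1. *)
have := s_all false; have := s_all true.
rewrite expr0 expr1 scale1r scaleN1r => dvdB dvdD.
split.
  rewrite -(dvdpZr _ _ nz2).
  have -> : 2%:R *: f = (f - g * 'X) + (f + g * 'X).
    by rewrite scaler_nat mulr2n addrACA addNr addr0.
  by rewrite dvdp_add.
rewrite -(@Gauss_dvdpl _ _ 'X).
  rewrite -(dvdpZr _ _ nz2).
  have -> : 2%:R *: (g * 'X) = (f + g * 'X) - (f - g * 'X).
    by rewrite scaler_nat mulr2n opprB [f + _]addrC addrACA subrr addr0.
  by rewrite dvdp_sub.
rewrite coprimepX rootE !hornerE expr0n expn_eq0 /=.
by rewrite sub0r oppr_eq0 oner_eq0.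
Qed.

End Assembly.

(** * Irreducible factors of X^(2^k) + 1 *)

Section FactorizationTheory.
Local Open Scope ring_scope.
Variable K : fieldType.
Implicit Types (P Q u g : {poly K}) (s : seq {poly K}).

Lemma factorization_mul P Q s t :
    irreducible_factorization P s -> irreducible_factorization Q t ->
  irreducible_factorization (P * Q) (s ++ t).
Proof.
move=> [irr_s Ps] [irr_t Qt]; split; last first.
  by rewrite big_cat; apply: eqp_trans (eqp_mull _ Qt) (eqp_mulr _ Ps).
by move=> p; rewrite mem_cat => /orP[/irr_s | /irr_t].
Qed.

Lemma factorization_irreducible P :
  irreducible_poly P -> irreducible_factorization P [:: P].
Proof. by split=> [p|]; [rewrite inE => /eqP-> | rewrite big_seq1 eqpxx]. Qed.

Lemma factorization_nonempty P s :
  irreducible_factorization P s -> (1 < size P)%N -> (0 < size s)%N.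
Proof.
by case: s => // -[_ /eqp_size]; rewrite big_nil size_poly1 => ->.
Qed.

(* The boolean b records whether the number of factors is known exactly or    *)
(* only bounded below.                                                        *)
Lemma factorization_X2n_sub1 (b : bool) (l : nat -> nat) m :
    (forall k, (k < m)%N -> exists s,
       [/\ irreducible_factorization ('X^(2 ^ k) + 1) s, (l k <= size s)%N
         & b -> size s = l k]) ->
  exists s, [/\ irreducible_factorization ('X^(2 ^ m) - 1) s,
    (1 + \sum_(k < m) l k <= size s)%N & b -> size s = (1 + \sum_(k < m) l
      k)%N].
Proof.
elim: m => [_ | m IH fact].
  exists [:: 'X - 1]; rewrite big_ord0; split=> //.
  by rewrite expr1; apply: factorization_irreducible; apply: irredp_XsubC.
have [k lt_k | s [fs ls es]] := IH; first by apply: fact; apply: ltnW.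
have [t [ft lt et]] := fact m (ltnSn m).
exists (s ++ t); rewrite size_cat big_ord_recr /= addnA; split.
- by rewrite X2n_sub1_factor; apply: factorization_mul.
- exact: leq_add.
- by move=> hb; rewrite es ?et.
Qed.

End FactorizationTheory.

(** * Splitting X^(2^k) + 1 over a finite field of odd order *)

Section FiniteFactorization.
Local Open Scope ring_scope.
Variable K : finFieldType.
Implicit Types (P Q u g : {poly K}).

Lemma factorization_exists P : P != 0 ->
  exists s, irreducible_factorization P s.
Proof.
have [k] := ubnP (size P); elim: k P => // k IH P lt_P nzP.
have [P1 | P_gt1] := leqP (size P) 1.
  exists [::]; split=> //; rewrite big_nil -size_poly_eq1 eqn_leq P1.
  by rewrite size_poly_gt0.
have [/irreducibleP irrP | ] := boolP (irreducibleb P).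
  by exists [:: P]; apply: factorization_irreducible.
rewrite /irreducibleb P_gt1 negb_forall => /existsP[q].
rewrite negb_imply -ltnNge => /andP[dvd_qP q_gt1].
have {dvd_qP} dvd_qP : (q : {poly K}) %| P by rewrite dvdpE.
have lt_qP : (size (q : {poly K}) < size P)%N.
  by apply: leq_ltn_trans (size_npoly q) _; rewrite ltn_predL ltnW.
have [w Pwq] := dvdpP _ _ dvd_qP.
have : w * (q : {poly K}) != 0 by rewrite -Pwq.
rewrite mulf_eq0 negb_or => /andP[nzw nzq].
have lt_wP : (size w < size P)%N.
  rewrite Pwq size_mul //; case: (size q) q_gt1 => [|[|d]] // _.
  by rewrite !addnS ltnS leq_addr.
have [s fs] := IH w (leq_trans lt_wP lt_P) nzw.
have [t ft] := IH q (leq_trans lt_qP lt_P) nzq.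
by exists (s ++ t); rewrite Pwq; apply: factorization_mul.
Qed.

Lemma irreducible_of_min_degree u : (1 < size u)%N ->
    (forall g, irreducible_poly g -> g %| u -> (size u <= size g)%N) ->
  irreducible_poly u.
Proof.
move=> u_gt1 min_u; split=> // q q1 dvd_q.
have nzu : u != 0 by rewrite -size_poly_gt0 ltnW.
have nzq : q != 0 by apply: contraTneq dvd_q => ->; rewrite dvd0p.
have [[|g s] fact_q] := factorization_exists nzq.
  by have [_ /eqp_size] := fact_q; rewrite big_nil size_poly1 => /eqP;
    rewrite (negbTE q1).
have dvd_g := factorization_dvdp fact_q (mem_head g s).
rewrite -dvdp_size_eqp // eqn_leq dvdp_leq //=.
apply: leq_trans (dvdp_leq nzq dvd_g); apply: min_u (dvdp_trans dvd_g dvd_q).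
exact: fact_q.1 (mem_head g s).
Qed.

Hypothesis oddK : odd #|K|.

Lemma odd_card_nz2 : 2%:R != 0 :> K.
Proof.
(* In the additive group, #|K| times 1 is 0; if 2 = 0 this odd multiple would also be 1. *)
apply/eqP=> K2; have := expg_cardG (in_setT (1%R : K)).
rewrite cardsT FinRing.zmodXgE -(odd_double_half #|K|) oddK natrD -mul2n natrM
  K2.
by rewrite mul0r addr0 => /eqP; rewrite oner_eq0.
Qed.

(* The unit group is cyclic, so that a product of two nonsquares is a square. *)
Lemma square_neg1_or_2 :
  exists a : K, [\/ a ^+ 2 = -1, a ^+ 2 = 2%:R | a ^+ 2 = - 2%:R].
Proof.
have /cyclicP[g Dg] := field_unit_group_cyclic [set: {unit K}]%G.
have pow (a : K) : a != 0 -> exists i, a = (val g) ^+ i.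
  move=> a0; have ua : a \is a GRing.unit by rewrite unitfE.
  have /cycleP[i Di] : FinRing.unit K ua \in <[g]>%g by rewrite -Dg inE.
  by exists i; rewrite -FinRing.val_unitX -Di.
have sqr (a : K) i : a = (val g) ^+ i -> ~~ odd i -> exists b : K, b ^+ 2 = a.
  move=> -> even_i; exists ((val g) ^+ i./2).
  by rewrite -exprM muln2 even_halfK.
have [i Di] : exists i, -1 = (val g) ^+ i by apply: pow;
  rewrite oppr_eq0 oner_eq0.
have [j Dj] := pow _ odd_card_nz2.
have [odd_i | even_i] := boolP (odd i); last first.
  by have [b Db] := sqr _ _ Di even_i; exists b; constructor 1.
have [odd_j | even_j] := boolP (odd j); last first.
  by have [b Db] := sqr _ _ Dj even_j; exists b; constructor 2.
have [||b Db] := sqr (- 2%:R) (i + j)%N; last by exists b; constructor 3.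
  by rewrite exprD -Di -Dj mulN1r.
by rewrite oddD odd_i odd_j.
Qed.

(** The factors are X^2 + a and X^2 - a if a^2 = -1, X^2 + aX + 1 and X^2 - aX + 1 if a^2 = 2, and
    X^2 + aX - 1 and X^2 - aX - 1 if a^2 = -2. *)
Lemma X4_add1_split : exists u v : {poly K},
  [/\ size u = 3%N, size v = 3%N & u * v = 'X^4 + 1].
Proof.
have size3 (a b : K) : size (('X + a%:P) * 'X + b%:P) = 3%N.
  by rewrite size_MXaddC -size_poly_eq0 size_XaddC.
have [a [Da|Da|Da]] := square_neg1_or_2; have /(congr1 polyC) := Da;
  rewrite polyC_exp ?polyCN ?polyC1 => DaP.
- exists (('X + 0%:P) * 'X + a%:P), (('X + 0%:P) * 'X + (- a)%:P); split=> //.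
  transitivity ('X^4 - a%:P ^+ 2); last by rewrite DaP opprK.
  by rewrite polyCN; ring.
- exists (('X + a%:P) * 'X + 1%:P), (('X + (- a)%:P) * 'X + 1%:P); split=> //.
  transitivity ('X^4 + (2%:R - a%:P ^+ 2) * 'X^2 + 1);
    last by rewrite DaP polyC_natr subrr mul0r addr0.
  by rewrite polyCN; ring.
exists (('X + a%:P) * 'X + (-1)%:P), (('X + (- a)%:P) * 'X + (-1)%:P);
  split=> //.
transitivity ('X^4 + (- 2%:R - a%:P ^+ 2) * 'X^2 + 1);
  last by rewrite DaP polyC_natr subrr mul0r addr0.
by rewrite !polyCN; ring.
Qed.

Lemma X2n_add1_split k : exists u v : {poly K},
  [/\ size u = (2 ^ k.+1).+1, size v = (2 ^ k.+1).+1
    & u * v = 'X^(2 ^ k.+2) + 1].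
Proof.
have [u [v [size_u size_v uv]]] := X4_add1_split.
have size3 (w : {poly K}) :
    size w = 3%N -> size (w \Po 'X^(2 ^ k)) = (2 ^ k.+1).+1.
  move=> size_w; have w0 : w \Po 'X^(2 ^ k) != 0.
    by rewrite comp_poly_eq0 ?size_polyXn ?ltnS ?expn_gt0 // -size_poly_eq0
      size_w.
  rewrite -[LHS]prednK ?size_poly_gt0 // size_comp_poly size_w size_polyXn.
  by rewrite expnS.
exists (u \Po 'X^(2 ^ k)), (v \Po 'X^(2 ^ k)); rewrite !size3 //; split=> //.
rewrite -comp_polyM uv comp_polyD comp_Xn_poly comp_polyC -exprM.
by rewrite -[4%N]/(2 ^ 2)%N -expnD addn2.
Qed.

End FiniteFactorization.

(** * The order of q modulo powers of 2 when q = 3 mod 8 *)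

Section Order.
Implicit Types q d k : nat.

Lemma exp_2X_mod q k : q = 3 %[mod 8] ->
  q ^ (2 ^ k.+1) = 1 + 2 ^ (k + 3) %[mod 2 ^ (k + 4)].
Proof.
move=> q3; elim: k => [|k IH].
  have [c ->] : exists c, q = 8 * c + 3 by exists (q %/ 8); lia.
  rewrite expn1 (_ : _ ^ 2 = (4 * c ^ 2 + 3 * c) * 2 ^ 4 + (1 + 2 ^ 3));
    last by ring.
  by rewrite modnMDl.
rewrite expnSr expnM; set a := q ^ (2 ^ k.+1) in IH *.
pose T := 2 ^ (k + 1); have T_gt0 : 0 < T by rewrite expn_gt0.
have pow i : 2 ^ (k + i.+1) = 2 ^ i * T by rewrite /T -expnD; congr (2 ^ _);
  lia.
rewrite !addSnnS !pow in IH *; have [c ->] : exists c, a = c * (2 ^ 3 * T) + (1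
  + 2 ^ 2 * T).
  by exists (a %/ (2 ^ 3 * T)); rewrite [LHS](divn_eq a (2 ^ 3 * T)) IH
    modn_small; lia.
(* This is the square of 1 + 4T(2c + 1): squaring doubles the term 4T modulo 16T. *)
rewrite (_ : _ ^ 2 = (c + T * (2 * c + 1) ^ 2) * (2 ^ 4 * T) + (1 + 2 ^ 3 * T)).
  by rewrite modnMDl.
by ring.
Qed.

Lemma dvdn_exp_mod8 q d k : q = 3 %[mod 8] ->
  q ^ d = 1 %[mod 2 ^ (k + 3)] -> 2 ^ k.+1 %| d.
Proof.
move=> q3; elim: k d => [|k IH] d qd.
  rewrite expn1 dvdn2; apply/negP=> odd_d; move: qd.
  rewrite -modnXm q3 -[d]odd_double_half odd_d -mul2n expnD expnM.
  by rewrite -modnMmr -modnXm exp1n.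
have /dvdnP[e De] : 2 ^ k.+1 %| d.
  by apply: IH; rewrite -(modn_dvdm (q ^ d) (dvdn_exp2l 2 (leqnSn _)))
    -[in RHS](modn_dvdm 1 (dvdn_exp2l 2 (leqnSn _))) -addSn qd.
move: qd; rewrite De [2 ^ k.+2]expnS dvdn_pmul2r ?expn_gt0 // dvdn2 => qd.
(* With M = 2^(k+3), q^(2^(k+1)) is 1 + M modulo 2M and has square 1, so an odd power of it is still
   1 + M, not 1. *)
apply/negP=> odd_e; move: qd.
set M := 2 ^ (k + 3); have M2 : 2 ^ (k.+1 + 3) = 2 * M by rewrite -expnS.
rewrite mulnC expnM -modnXm M2.
have -> : q ^ (2 ^ k.+1) = 1 + M %[mod 2 * M].
  by have := exp_2X_mod k q3; rewrite addnS -M2 addSn.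
have [U U_gt0 MU] : exists2 U, 0 < U & M = 2 * U.
  by exists (2 ^ (k + 2)); rewrite ?expn_gt0 // -expnS -addnS.
rewrite modnXm -[e]odd_double_half odd_e -mul2n expnD expnM expn1.
have sqrM : (1 + M) ^ 2 = 1 %[mod 2 * M].
  by rewrite MU (_ : _ ^ 2 = (1 + U) * (2 * (2 * U)) + 1) ?modnMDl //; ring.
rewrite -modnMmr -modnXm sqrM modnXm exp1n modnMmr muln1.
by rewrite !modn_small; lia.
Qed.

End Order.

Section FiniteOrder.
Local Open Scope ring_scope.
Variable K : finFieldType.
Implicit Types (u g : {poly K}).

(** A root of [g] has order exactly 2^(k+1), since its 2^k-th power is -1, different from 1; and it
    lies in the unit group of a field of #|K|^(deg g) elements. *)
Lemma dvdn_order_root g k : 2%:R != 0 :> K -> irreducible_poly g ->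
  g %| 'X^(2 ^ k) + 1 -> (2 ^ k.+1 %| (#|K| ^ (size g).-1).-1)%N.
Proof.
move=> nz2 irr_g dvd_g; have [L dimL [z gz0 _]] := irredp_FAdjoin irr_g.
have zk : z ^+ (2 ^ k) = -1.
  have [w Dw] := dvdpP _ _ dvd_g.
  have /(congr1 (horner_alg z)) := Dw.
  rewrite rmorphD rmorphM /= rmorphXn /= horner_algX rmorph1.
  rewrite [horner_alg z g](rootP gz0) mulr0 => /eqP.
  by rewrite addr_eq0 => /eqP.
have nzz : z != 0.
  apply/eqP=> z0; move/eqP: zk; rewrite z0 expr0n expn_eq0 /= eq_sym.
  by rewrite oppr_eq0 oner_eq0.
have ord_z : (2 ^ k.+1).-primitive_root z.
  have z1 : z ^+ (2 ^ k.+1) = 1 by rewrite expnSr exprM zk sqrrN expr1n.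
  have [j prim_j] := prim_order_exists (expn_gt0 2 k.+1) z1.
  move/(dvdn_pfactor _ _ (isT : prime 2)) => [i]; rewrite leq_eqVlt ltnS.
  case/predU1P=> [-> <- // | le_ik Dj].
  have : z ^+ (2 ^ k) = 1.
    by rewrite -(subnKC le_ik) expnD exprM -Dj (prim_expr_order prim_j) expr1n.
  rewrite zk => /eqP; rewrite eq_sym -subr_eq0 opprK -[1 + 1]/(2%:R).
  by rewrite -(rmorph_nat (in_alg L)) fmorph_eq0 (negbTE nz2).
rewrite (prim_order_dvd ord_z) -dimL.
have := expf_card (z : finvect_type L).
have -> : #|finvect_type L| = (#|K| ^ \dim {: L})%N.
  pose V : vectType K := finvect_type L.
  by rewrite -(@card_vspacef K (finvect_type L) (Vector.class V)) card_vspace.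
move=> zq.
apply/eqP/(mulfI nzz); rewrite mulr1 -exprS prednK //.
by rewrite expn_gt0 -[#|K|]prednK // ; apply/card_gt0P; exists 0.
Qed.

End FiniteOrder.

Section X2nAdd1.
Local Open Scope ring_scope.

Lemma size_Xn_add1 (R : nzRingType) n : (0 < n)%N -> size ('X^n + 1 : {poly R})
  = n.+1.
Proof. by move=> n_gt0; rewrite size_polyDl size_polyXn // size_poly1. Qed.

Lemma finite_X2n_add1_factorization (K : finFieldType) k : odd #|K| ->
  exists s : seq {poly K},
    [/\ irreducible_factorization ('X^(2 ^ k) + 1) s, ((1 < k).+1 <= size s)%N
      & (#|K| %% 8 == 3)%N -> size s = (1 < k).+1].
Proof.
move=> oddK; have nz2 := odd_card_nz2 oddK.
have nzP j : 'X^(2 ^ j) + 1 != 0 :> {poly K}.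
  by rewrite -size_poly_eq0 size_Xn_add1 ?expn_gt0.
have ord (g : {poly K}) j : irreducible_poly g -> g %| 'X^(2 ^ j) + 1 ->
    (#|K| ^ (size g).-1 = 1 %[mod 2 ^ j.+1])%N.
  move=> irr_g /(dvdn_order_root nz2 irr_g)/dvdnP[c Dc].
  have q_gt0 : (0 < #|K| ^ (size g).-1)%N by rewrite expn_gt0; case: #|K| oddK.
  by rewrite -(prednK q_gt0) Dc -addn1 modnMDl.
case: k => [|[|k]].
- exists [:: 'X + 1]; split=> //; rewrite expr1.
  exact/factorization_irreducible/irredp_XaddC.
- have size2 : size ('X^(2 ^ 1) + 1 : {poly K}) = 3%N by rewrite size_Xn_add1.
  have [q3|_] := boolP (#|K| %% 8 == 3)%N.
    exists [:: 'X^(2 ^ 1) + 1]; split=> //.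
    apply/factorization_irreducible/irreducible_of_min_degree; rewrite size2 //.
    move=> g irr_g /(ord g 1%N irr_g); have := irr_g.1.
    case: (size g) => [|[|[|]]] //= _.
    by rewrite expn1 -[(2 ^ 2)%N]/4%N; move/eqP: q3; move: #|K| => c; lia.
  have [s fs] := factorization_exists (nzP 1%N).
  by exists s; split=> //; apply: factorization_nonempty fs _; rewrite size2.
have [u [v [size_u size_v uv]]] := X2n_add1_split oddK k.
have size_gt1 (w : {poly K}) : size w = (2 ^ k.+1).+1 -> (1 < size w)%N.
  by move->; rewrite ltnS expn_gt0.
have [q3|_] := boolP (#|K| %% 8 == 3)%N.
  (* By the order of q modulo 2^(k+3), each irreducible factor has degree divisible by 2^(k+1),
     which is already the degree of [w]. *)
  have irr (w : {poly K}) : size w = (2 ^ k.+1).+1 -> w %| 'X^(2 ^ k.+2) + 1 ->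
      irreducible_poly w.
    move=> size_w dvd_w; apply: irreducible_of_min_degree;
      first exact: size_gt1.
    move=> g irr_g dvd_g; have := ord g k.+2 irr_g (dvdp_trans dvd_g dvd_w).
    rewrite -addn3 => /(dvdn_exp_mod8 (eqP q3))/dvdn_leq.
    by have := irr_g.1; rewrite size_w; case: (size g) => [|[|d]] //= _; apply.
  have irr_u : irreducible_poly u by apply: irr => //; rewrite -uv dvdp_mulr.
  have irr_v : irreducible_poly v by apply: irr => //; rewrite -uv dvdp_mull.
  exists [:: u; v]; split=> //; rewrite -uv -[[:: u; v]]/([:: u] ++ [:: v]).
  by apply: factorization_mul; apply: factorization_irreducible.
have [s fs] : exists s, irreducible_factorization u s.
  by apply: factorization_exists; rewrite -size_poly_gt0 size_u.
have [t ft] : exists t, irreducible_factorization v t.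
  by apply: factorization_exists; rewrite -size_poly_gt0 size_v.
exists (s ++ t); split=> //; first by rewrite -uv; apply: factorization_mul.
rewrite size_cat (@leq_add 1 1) //.
  by apply: factorization_nonempty fs _; apply: size_gt1.
by apply: factorization_nonempty ft _; apply: size_gt1.
Qed.

(** The polynomial vanishes at a primitive 2^(k+1)-th root of unity, whose minimal polynomial is
    cyclotomic of the same degree 2^k. *)
Lemma rat_X2n_add1_irreducible k : irreducible_poly ('X^(2 ^ k) + 1 : {poly
  rat}).
Proof.
have [z prim_z] := C_prim_root_exists (expn_gt0 2 k.+1).
have zk : z ^+ (2 ^ k) = -1.
  have /eqP : (z ^+ (2 ^ k)) ^+ 2 = 1 by rewrite -exprM -expnSr prim_expr_order.
  rewrite sqrf_eq1 -(prim_order_dvd prim_z) dvdn_Pexp2l // ltnn.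
  by move/eqP.
have [p [Dp mon_p dv_p]] := minCpolyP z.
have size_p : size p = (2 ^ k).+1.
  rewrite -(size_map_poly (ratr : {rmorphism rat -> algC})) -Dp.
  rewrite (minCpoly_cyclotomic prim_z) size_cyclotomic.
  by rewrite totient_pfactor // mul1n.
have pz P : root (map_poly ratr P) z -> p %| P by rewrite dv_p.
have eq_p : p %= 'X^(2 ^ k) + 1.
  rewrite -dvdp_size_eqp ?size_p ?size_Xn_add1 ?expn_gt0 // -dv_p.
  by rewrite rmorphD rmorph1 /= map_polyXn rootE !hornerE zk addNr.
split=> [|q q1]; first by rewrite size_Xn_add1 ?ltnS expn_gt0.
rewrite -!(eqp_dvdr _ eq_p) -(eqp_rtrans eq_p) => dvd_q.
have [w Dw] := dvdpP _ _ dvd_q.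
have : root (map_poly ratr (w * q)) z by rewrite -Dw dv_p.
rewrite rmorphM /= rootM !dv_p => /orP[dvd_w | dvd_pq]; last first.
  by rewrite /eqp dvd_q.
case/negP: q1; rewrite -dvdp1; have [u Du] := dvdpP _ _ dvd_w.
apply/dvdpP; exists u; apply: (mulIf (monic_neq0 mon_p)).
by rewrite mul1r mulrAC -Du.
Qed.

End X2nAdd1.

(** * Quaternion algebras over finite fields *)

Section LeftIdeal.
Local Open Scope ring_scope.
Variables (L : fieldType) (D : falgType L) (e : nat).
Variables (V : {vspace D}) (b : e.+1.-tuple D).
Hypotheses (basis_b : basis_of V b).
Hypothesis idealV : forall d v, v \in V -> d * v \in V.

(** Left multiplication by [d] on the left ideal [V], with the image of the j-th basis vector in
    column j, so that products keep their order. *)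
Definition ideal_mx (_ : basis_of V b) (_ : forall d v, v \in V -> d * v \in V)
  (d : D) : 'M[L]_e.+1 := \matrix_(i, j) coord b i (d * b`_j).
Local Notation rho := (ideal_mx basis_b idealV).

Fact ideal_mx_linear : linear rho.
Proof.
by move=> k c d; apply/matrixP=> i j; rewrite !mxE mulrDl -scalerAl linearP.
Qed.

HB.instance Definition _ := GRing.isLinear.Build L D 'M[L]_e.+1 *:%R rho
  ideal_mx_linear.

Lemma basis_memV (j : 'I_e.+1) : b`_j \in V.
Proof. by apply: (basis_mem basis_b); rewrite mem_nth ?size_tuple. Qed.

Fact ideal_mx_monoid : monoid_morphism rho.
Proof.
split=> [|c d]; apply/matrixP=> i j; rewrite !mxE.
  by rewrite mul1r (coord_free _ _ (basis_free basis_b)) eq_sym.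
rewrite -mulrA [d * _](coord_basis basis_b) ?idealV ?basis_memV //.
rewrite mulr_sumr linear_sum /=; apply: eq_bigr => k _.
by rewrite -scalerAr linearZ !mxE /= mulrC.
Qed.

HB.instance Definition _ := GRing.isMonoidMorphism.Build D 'M[L]_e.+1 rho
  ideal_mx_monoid.

Lemma ideal_mx_inj : simple_ring D -> injective rho.
Proof.
move=> simD; have [|J0|/(_ 1)] := simD (fun d => rho d = 0).
- split=> [|c d c0 d0|c d d0]; first exact: rmorph0.
    by rewrite rmorphB /= c0 d0 subr0.
  by split; rewrite rmorphM /= d0 ?mulr0 ?mul0r.
- by move=> c d eq_cd; apply/subr0_eq/J0; rewrite rmorphB /= eq_cd subrr.
by rewrite rmorph1 => /eqP; rewrite oner_eq0.
Qed.

Lemma ideal_mx_dim : simple_ring D -> (\dim {: D} <= e.+1 ^ 2)%N.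
Proof.
move=> simD; have inj := ideal_mx_inj simD.
have ker0 : lker (linfun rho) == 0%VS.
  by apply/lker0P=> c d; rewrite !lfunE => /inj.
rewrite -(limg_dim_eq (_ : fullv :&: lker (linfun rho) = 0)%VS); last first.
  by rewrite (eqP ker0) capv0.
apply: leq_trans (dimvS (subvf _)) _; rewrite dimvf /dim /=.
by rewrite mulnn.
Qed.

End LeftIdeal.

Section Split.
Local Open Scope ring_scope.
Variables (L : fieldType) (D : falgType L).
Hypotheses (simD : simple_ring D) (dimD : \dim {: D} = 4%N).

(** A left ideal of dimension 1 would embed the 4-dimensional [D] in 1 x 1 matrices. *)
Lemma left_ideal_dim (V : {vspace D}) : (forall d v, v \in V -> d * v \in V) ->
  V != 0%VS -> (1 < \dim V)%N.
Proof.
move=> idealV nzV; have b := vbasisP V.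
move: (vbasis V) b; rewrite -dimv_eq0 -lt0n in nzV;
  case: (\dim V) nzV => // e _ b basis_b.
have := ideal_mx_dim basis_b idealV simD; rewrite dimD.
by case: e {b basis_b}.
Qed.

(* Both D b and the left annihilator of b are nonzero left ideals, and a left *)
(* ideal of dimension e embeds D in M_e(L); hence both have dimension 2.      *)
Lemma zero_divisor_matrix2 (a b : D) : a != 0 -> b != 0 -> a * b = 0 ->
  exists rho : {lrmorphism D -> 'M[L]_2}, bijective rho.
Proof.
move=> nza nzb ab0.
pose f := amulr b; pose V := limg f; pose W := lker f.
have idealV d v : v \in V -> d * v \in V.
  case/memv_imgP=> c _ ->; rewrite lfunE /= mulrA.
  by rewrite (_ : d * c * b = f (d * c)) ?memv_img ?memvf // lfunE.
have idealW d v : v \in W -> d * v \in W.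
  by rewrite !memv_ker !lfunE /= -mulrA => /eqP->; rewrite mulr0.
have nzV : V != 0%VS.
  apply: contraNneq nzb => V0; rewrite -memv0 -V0 -[b]mul1r.
  by rewrite (_ : 1 * b = f 1) ?memv_img ?memvf // lfunE.
have nzW : W != 0%VS.
  apply: contraNneq nza => W0; rewrite -memv0 -W0 memv_ker lfunE /= ab0 eqxx.
  by [].
have dimV : \dim V = 2%N.
  have := limg_ker_dim f fullv; rewrite capfv dimD -/V -/W.
  by have := left_ideal_dim idealV nzV; have := left_ideal_dim idealW nzW; lia.
have := vbasisP V; move: (vbasis V); rewrite dimV => c basis_c.
pose rho : {lrmorphism D -> 'M[L]_2} := ideal_mx basis_c idealV.
exists rho; have inj : injective rho by apply: ideal_mx_inj.
have ker0 : lker (linfun rho) == 0%VS.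
  by apply/lker0P=> d d'; rewrite !lfunE => /inj.
have img : limg (linfun rho) = fullv.
  apply/eqP; rewrite eqEdim subvf limg_dim_eq ?(eqP ker0) ?capv0 //.
  by rewrite dimD dimvf.
exists ((linfun rho)^-1)%VF => d; first by rewrite -[rho d]lfunE lker0_lfunK.
by rewrite -[LHS]lfunE limg_lfunVK ?img ?memvf.
Qed.

End Split.

Section FiniteQuaternion.
Local Open Scope ring_scope.

Lemma finite_domain_commutative (L : finFieldType) (D : falgType L) :
  GRing.integral_domain_axiom D -> commutative (@GRing.mul D).
Proof.
by move=> dom; apply: (@finDomain_mulrC (finvect_type D) dom).
Qed.

(* By Wedderburn's little theorem a finite division algebra is commutative.   *)
Lemma finite_quaternion_matrix_ring2 (K : finFieldType) (B : algType K) :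
  quaternion_algebra B -> matrix_ring2 B.
Proof.
case=> L [D [cD simD dimD [phi bij_phi]]].
have [[a [b [nza nzb ab0]]] | nodiv] :=
  classic (exists a b : D, [/\ a != 0, b != 0 & a * b = 0]); last first.
  have dom : GRing.integral_domain_axiom D.
    move=> a b ab0; apply/norP=> -[nza nzb]; case: nodiv.
    by exists a, b.
  have comm : commutative (@GRing.mul D).
    exact: (@finite_domain_commutative (finvect_type L) D dom).
  (* A commutative [D] equals its centre, the scalars, contradicting dimension 4. *)
  suff : (\dim {: D} <= \dim (1%VS : {vspace D}))%N by rewrite dimD dimv1.
  apply/dimvS/subvP=> z _; have [c ->] := cD z (comm z).
  by rewrite memvZ ?memv_line.
have [rho bij_rho] := zero_divisor_matrix2 simD dimD nza nzb ab0.
pose psi : B -> 'M[L]_2 := rho \o phi.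
have psiD : zmod_morphism psi by move=> u v; rewrite /psi /= !rmorphB.
have psiZ : scalable_for (GRing.in_alg L \; *:%R) psi.
  by move=> k u; rewrite /psi /= linearZ /= linearZ.
have psiM : monoid_morphism psi.
  by split=> [|u v]; rewrite /psi /= ?rmorph1 ?rmorphM.
pose psi' : {lrmorphism B -> 'M[L]_2 | GRing.in_alg L \; *:%R} :=
  HB.pack psi (GRing.isZmodMorphism.Build B 'M[L]_2 psi psiD)
   (GRing.isScalable.Build K B 'M[L]_2 (GRing.in_alg L \; *:%R) psi psiZ)
   (GRing.isMonoidMorphism.Build B 'M[L]_2 psi psiM).
by exists L, psi'; apply: bij_comp.
Qed.

End FiniteQuaternion.

(** * Wedderburn decompositions *)

Lemma quaternion_simple (K : fieldType) (B : algType K) :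
  quaternion_algebra B -> simple_ring B.
Proof.
case=> L [D [_ simD _ [phi [psi phiK psiK]]]] J [J0 JB JM].
have [|D0|DT] := simD (fun d => J (psi d)).
- split=> [|c d Jc Jd|c d Jd].
  + by rewrite -(rmorph0 phi) phiK.
  + by rewrite -(psiK c) -(psiK d) -rmorphB phiK; apply: JB.
  + by rewrite -(psiK c) -(psiK d) -!rmorphM !phiK; apply: JM.
- left=> b Jb; apply: (can_inj phiK); rewrite rmorph0; apply: D0.
  by rewrite phiK.
by right=> b; rewrite -(phiK b).
Qed.

Lemma sum_finite_factors j : (\sum_(k < j.+2) (1 < k).+1 = 2 * j.+1)%N.
Proof.
elim: j => [|j IH]; first by rewrite !big_ord_recr big_ord0.
by rewrite big_ord_recr IH /=; lia.
Qed.

Section WedderburnSum.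
Variables (K : fieldType) (A : algType K) (a b : nat).
Variables (F : 'I_a -> fieldExtType K) (Q : 'I_b -> algType K).
Variable p : forall i, {lrmorphism A -> sum_family F Q i}.
Hypotheses (quatQ : forall j, quaternion_algebra (Q j)) (sep_p : separating p).

Lemma separating_wedderburn c : c = (a + b)%N ->
  exists B : 'I_c -> algType K, wedderburn_decomposition A B.
Proof.
move=> Dc; have [g bij_g] : exists g : 'I_c -> 'I_a + 'I_b, bijective g.
  by apply: card_eq_bijective; rewrite card_sum !card_ord.
exists (fun i => sum_family F Q (g i)); split=> [i|].
  case: (g i) => j; [exact: field_simple | exact: quaternion_simple (quatQ j)].
exact: separating_direct_sum (separating_reindex bij_g sep_p).
Qed.

Lemma separating_fields_and_quaternions : fields_and_quaternions A F Q.
Proof. by split=> //; apply: separating_direct_sum sep_p. Qed.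

End WedderburnSum.

Theorem theorem4p1 (m : nat) (hm : (3 <= m)%N) (gT : finGroupType)
    (hG : type_D2 m gT) :
  (exists (F : 'I_(2 * m + 2) -> fieldExtType rat) (Q : 'I_1 -> algType rat),
     fields_and_quaternions (group_algebra rat gT) F Q)
  /\
  (forall (K : finFieldType) (q : nat), #|K| = q -> odd q ->
     [/\ exists (n : nat) (B : 'I_n -> algType K),
           wedderburn_decomposition (group_algebra K gT) B,
         forall (n : nat) (B : 'I_n -> algType K),
           wedderburn_decomposition (group_algebra K gT) B -> (4 * m <= n)%N
       & (q = 3 %[mod 8])%N ->
         [/\ exists B : 'I_(4 * m) -> algType K,
               wedderburn_decomposition (group_algebra K gT) B,
             exists (F : 'I_(4 * m - 2) -> fieldExtType K)
                    (Q : 'I_2 -> algType K),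
               fields_and_quaternions (group_algebra K gT) F Q
           & forall (F : 'I_(4 * m - 2) -> fieldExtType K)
                    (Q : 'I_2 -> algType K),
               fields_and_quaternions (group_algebra K gT) F Q ->
               forall j, matrix_ring2 (Q j)]]).
Proof.
case: m hm hG => [|[|[|n]]] // _ hG.
have [phi [psi phiK psiK] phiM] := type_D2_d2group hG.
split=> [|K q cardK oddq].
  have [s [fs _ /(_ isT) size_s]] := factorization_X2n_sub1 (b := true) (m :=
    n.+3)
    (fun k _ => ex_intro _ _ (And3 (factorization_irreducible
      (rat_X2n_add1_irreducible k)) (leqnn 1) (fun _ => erefl))).
  have nz2 : (2%:R != 0 :> rat)%R by [].
  have := d2_separating phiK psiK phiM isT nz2 fs
    (factorization_irreducible (rat_X2n_add1_irreducible n.+2)).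
  have -> : (size s * 2 = 2 * n.+3 + 2)%N.
    by rewrite size_s sum_nat_const card_ord; lia.
  case=> F [Q [p [quatQ sep_p]]]; exists F, Q.
  exact: separating_fields_and_quaternions quatQ sep_p.
rewrite -{q}cardK in oddq *; have nz2 := odd_card_nz2 oddq.
have [s [fs le_s eq_s]] := factorization_X2n_sub1
  (fun k (_ : k < n.+3) => finite_X2n_add1_factorization k oddq).
have [r [fr /= le_r eq_r]] := finite_X2n_add1_factorization n.+2 oddq.
have [F [Q [p [quatQ sep_p]]]] := d2_separating phiK psiK phiM isT nz2 fs fr.
have wedderburn c := separating_wedderburn (c := c) quatQ sep_p.
rewrite sum_finite_factors in le_s eq_s; split.
- by exists (size s * 2 + size r)%N; apply: wedderburn.
- move=> c B /(separating_card_leq sep_p); rewrite card_sum !card_ord => le_c.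
  apply: leq_trans le_c.
  by apply: leq_trans (leq_add (leq_mul le_s (leqnn 2)) le_r); lia.
move=> /eqP q3; have {}eq_s := eq_s q3; have {}eq_r := eq_r q3.
have Ds : (size s * 2 = 4 * n.+3 - 2)%N by rewrite eq_s; lia.
split; first by apply: wedderburn; rewrite eq_s eq_r; lia.
  (* The index types depend on the numbers of factors, so the families are generalized before these
     numbers are replaced. *)
  move: F Q p quatQ sep_p {wedderburn}; rewrite Ds eq_r => F Q p quatQ sep_p.
  exists F, Q; exact: separating_fields_and_quaternions quatQ sep_p.
by move=> F' Q' [quatQ' _] j; apply: finite_quaternion_matrix_ring2.
Qed.
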